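(* Let $\mu$ be a locally finite, even and non-negative Borel measure on $\mathbb{R}$, let $\delta \ge 0$ and let $d \in \mathbb{N}$, $d\ge 1$. Then $$\mathbb{E}(\mu;\delta;d) = \mathbb{E}(\mu;\delta;1).$$
   Context: Norms on $\mathbb{C}^d$: $|\mathbf z| = (|z_1|^2+\dots+|z_d|^2)^{1/2}$ and $\|\mathbf z\| = \sup\{ |\sum_{n=1}^d z_n t_n| : \mathbf t\in\mathbb{R}^d,\ |\mathbf t|\le 1\}$. A not identically zero entire function $F:\mathbb{C}^d\to\mathbb{C}$ has exponential type if $\tau(F) := \limsup_{\|\mathbf z\|\to\infty} \|\mathbf z\|^{-1}\log|F(\mathbf z)| < \infty$, and then $\tau(F)$ is its exponential type; ''exponential type at most $\delta$'' means $\tau(F)\le\delta$ (the zero function is also allowed). An entire function $F:\mathbb{C}^d\to\mathbb{C}$ is real entire if its restriction to $\mathbb{R}^d$ is real-valued. A function $F:\mathbb{R}^d\to\mathbb{R}$ is eventually non-negative if $F(\mathbf x)\ge 0$ for all sufficiently large $|\mathbf x|$; in this case $r(F) := \inf\{r>0 : F(\mathbf x)\ge 0 \text{ for all } |\mathbf x|\ge r\}$. The lift $\mu^d$ of $\mu$ to $\mathbb{R}^d$ is the radial measure given in polar coordinates $\mathbf x = r\omega$ by $d\mu^d(\mathbf x) = d\sigma_{d-1}(\omega)\,d\mu(r)$, $r>0$, $\omega\in\mathbb{S}^{d-1}$, where $\sigma_{d-1}$ is the standard surface measure on the unit sphere $\mathbb{S}^{d-1}\subset\mathbb{R}^d$,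 and where a possible atom of $\mu$ at the origin is carried to an atom of $\mu^d$ at the origin of mass $\tfrac12\sigma_{d-1}(\mathbb{S}^{d-1})\,\mu(\{0\})$. Equivalently, for Borel $f\ge 0$, $\int_{\mathbb{R}^d} f\,d\mu^d = \tfrac12\int_{\mathbb{R}}\int_{\mathbb{S}^{d-1}} f(|r|\omega)\,d\sigma_{d-1}(\omega)\,d\mu(r)$. When $d=1$, $\mu^1=\mu$. $\mathcal{E}(\mu;\delta;d)$ is the class of real entire functions $F:\mathbb{C}^d\to\mathbb{C}$ of exponential type at most $\delta$ such that $F|_{\mathbb{R}^d}\in L^1(\mathbb{R}^d,\mu^d)$, $\int_{\mathbb{R}^d}F\,d\mu^d\le 0$, and $F|_{\mathbb{R}^d}$ is eventually non-negative. Set $\mathbb{E}(\mu;\delta;d) := \inf\{ r(F|_{\mathbb{R}^d}) : 0\ne F\in\mathcal{E}(\mu;\delta;d)\}$, with $\inf\emptyset = +\infty$. *)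

(* Defs.v *)
From HB Require Import structures.
From mathcomp Require Import all_boot all_order all_algebra.
From mathcomp Require Import complex.
From mathcomp Require Import all_classical all_reals all_analysis.
From mathcomp Require Import measurable_realfun.

Set Implicit Arguments.
Unset Strict Implicit.
Unset Printing Implicit Defensive.

Import Order.TTheory GRing.Theory Num.Theory.
Import numFieldNormedType.Exports.

Local Open Scope classical_set_scope.
Local Open Scope ring_scope.
Local Open Scope complex_scope.

(* Points of R^d are d-tuples, which the library equips with the product (that
   is, Borel) sigma-algebra; points of C^d are row vectors, which the library
   equips with a normed space structure over C. *)
Section euclidean.
Context {R : realType} {d : nat}.

Definition enorm (x : d.-tuple R) : R := Num.sqrt (\sum_(i < d) tnth x i ^+ 2).

Definition tscale (r : R) (x : d.-tuple R) : d.-tuple R :=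
  [tuple r * tnth x i | i < d].

Definition tzero : d.-tuple R := [tuple 0 | i < d].

Definition cembed (x : d.-tuple R) : 'rV[R[i]]_d := \row_i (tnth x i)%:C.

End euclidean.

Section lebesgue_tuple.
Context {R : realType}.

Definition tcons {d : nat} (p : measurableTypeR R * d.-tuple R) : d.+1.-tuple R :=
  [tuple of (p.1 : R) :: p.2].

Fixpoint lebesgue_tuple (d : nat) : set (d.-tuple R) -> \bar R :=
  match d with
  | 0 => \d_[tuple]
  | d'.+1 => pushforward (lebesgue_measure \x @lebesgue_tuple d')%E tcons
  end.

Lemma measurable_tcons d : measurable_fun setT (@tcons d).
Proof.
have mid : measurable_fun [set: measurableTypeR R] (idfun : _ -> R)
  by move=> _ A mA; rewrite setTI.
have m1 := measurableT_comp mid (@measurable_fst _ _ _ (d.-tuple R)).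
exact: (measurable_cons m1 measurable_snd).
Qed.

Section step.
Variables (d : nat) (m : {sigma_finite_measure set (d.-tuple R) -> \bar R}).

Let step := pushforward (lebesgue_measure \x m)%E (@tcons d).

Let M : {measure set (d.+1.-tuple R) -> \bar R} :=
  measure_function_pushforward__canonical__measure_function_Measure
    (lebesgue_measure \x m)%E (@measurable_tcons d).

Let step0 : step set0 = 0%E. Proof. exact: (measure0 M). Qed.

Let step_ge0 A : (0 <= step A)%E. Proof. exact: (measure_ge0 M). Qed.

Let step_sigma_additive : semi_sigma_additive step.
Proof. exact: (@measure_semi_sigma_additive _ _ _ M). Qed.

HB.instance Definition _ := isMeasure.Build _ _ _ step
  step0 step_ge0 step_sigma_additive.

Let step_sigma_finite : sigma_finite setT step.
Proof.
pose uncons (t : d.+1.-tuple R) : measurableTypeR R * d.-tuple R :=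
  (thead t, [tuple of behead t]).
have unconsK p : uncons (tcons p) = p.
  by case: p => a t; congr pair => //; exact: val_inj.
have muncons : measurable_fun setT uncons.
  apply/measurable_fun_pairP; split; last exact: measurable_behead.
  have mid : measurable_fun [set: R] (idfun : _ -> measurableTypeR R)
    by move=> _ A mA; rewrite setTI.
  exact: (measurableT_comp mid (@measurable_tnth _ R d.+1 ord0)).
have /sigma_finiteP[F [FT Fnd Foo]] := sigma_finiteT (@lebesgue_measure R).
have /sigma_finiteP[G [GT Gnd Goo]] := sigma_finiteT m.
have FGT : \bigcup_n (F n `*` G n) = setT.
  apply/seteqP; split => // -[x y] _.
  have [i _ Fix] : (\bigcup_n F n) x by rewrite -FT.
  have [j _ Gjy] : (\bigcup_n G n) y by rewrite -GT.
  exists (maxn i j) => //; split => /=.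
    by move: Fix; exact/subsetPset/Fnd/leq_maxl.
  by move: Gjy; exact/subsetPset/Gnd/leq_maxr.
exists (fun n => uncons @^-1` (F n `*` G n)).
  by rewrite -preimage_bigcup FGT preimage_setT.
move=> n; have [mF Fn] := Foo n; have [mG Gn] := Goo n; split.
  by rewrite -[X in measurable X]setTI; apply: muncons => //; exact: measurableX.
rewrite /step /pushforward (_ : tcons @^-1` _ = F n `*` G n); last first.
  rewrite -comp_preimage (_ : uncons \o tcons = idfun) ?preimage_id//.
  exact/funext.
by rewrite product_measure1E// lte_mul_pinfty// ge0_fin_numE.
Qed.

HB.instance Definition _ := Measure_isSigmaFinite.Build _ _ _ step
  step_sigma_finite.

Lemma lebesgue_tuple_step :
  exists m' : {sigma_finite_measure set (d.+1.-tuple R) -> \bar R}, step = m'.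
Proof. by exists step. Qed.

End step.

Let lebesgue_tuple_exists d :
  exists m : {sigma_finite_measure set (d.-tuple R) -> \bar R},
    @lebesgue_tuple d = m.
Proof.
elim: d => [|d [m lebE]]; first by exists \d_[tuple].
by rewrite /= lebE; exact: lebesgue_tuple_step.
Qed.

Let leb0 d : @lebesgue_tuple d set0 = 0%E.
Proof. by have [m ->] := lebesgue_tuple_exists d. Qed.

Let leb_ge0 d A : (0 <= @lebesgue_tuple d A)%E.
Proof. by have [m ->] := lebesgue_tuple_exists d. Qed.

Let leb_sigma_additive d : semi_sigma_additive (@lebesgue_tuple d).
Proof.
have [m ->] := lebesgue_tuple_exists d; exact: measure_semi_sigma_additive.
Qed.

HB.instance Definition _ d := isMeasure.Build _ _ _ (@lebesgue_tuple d)
  (leb0 d) (@leb_ge0 d) (@leb_sigma_additive d).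

Let leb_sigma_finite d : sigma_finite setT (@lebesgue_tuple d).
Proof. by have [m ->] := lebesgue_tuple_exists d; exact: sigma_finiteT. Qed.

HB.instance Definition _ d := Measure_isSigmaFinite.Build _ _ _
  (@lebesgue_tuple d) (@leb_sigma_finite d).

End lebesgue_tuple.

Section measurability.
Context {R : realType} {d : nat}.

Lemma enorm_ge0 (x : d.-tuple R) : 0 <= enorm x.
Proof. exact: sqrtr_ge0. Qed.

Lemma measurable_enorm : measurable_fun setT (@enorm R d).
Proof.
rewrite (_ : enorm = (fun r : R => r `^ 2^-1) \o
  (fun x : d.-tuple R => \sum_(i < d) tnth x i ^+ 2)); last first.
  by apply/funext => x /=; rewrite powR12_sqrt// sumr_ge0// => i _; exact: sqr_ge0.
apply: measurableT_comp; first exact: measurable_powR.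
by apply: measurable_sum => i; apply: measurable_funX; exact: measurable_tnth.
Qed.

Lemma measurable_tscale d' (T : measurableType d') (f : T -> R)
    (g : T -> d.-tuple R) : measurable_fun setT f -> measurable_fun setT g ->
  measurable_fun setT (fun t => tscale (f t) (g t)).
Proof.
move=> mf mg; apply/measurable_fun_tnthP => i.
rewrite (_ : _ \o _ = (fun t => f t * tnth (g t) i)); last first.
  by apply/funext => t /=; rewrite tnth_mktuple.
apply: measurable_funM => //.
exact: (measurableT_comp (@measurable_tnth _ R d i) mg).
Qed.

Lemma measurable_normalize :
  measurable_fun setT (fun x : d.-tuple R => tscale (enorm x)^-1 x).
Proof.
apply: measurable_tscale; last exact: measurable_id.
rewrite (_ : (fun _ => _) = (fun r : R => r `^ (-1)) \o enorm).
  exact: (measurableT_comp (measurable_powR (-1)) measurable_enorm).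
by apply/funext => x /=; rewrite powR_inv1// enorm_ge0.
Qed.

Lemma measurable_unit_ball :
  measurable [set x : d.-tuple R | 0 < enorm x <= 1].
Proof.
rewrite (_ : mkset _ = enorm @^-1` `]0, 1]); last first.
  by apply/seteqP; split => x /=; rewrite in_itv.
rewrite -[X in measurable X]setTI; apply: measurable_enorm => //.
Qed.

Lemma lebesgue_tuple_ball_lty :
  (lebesgue_tuple [set x : d.-tuple R | (0 < enorm x <= 1)%R] < +oo)%E.
Proof.
pose box n := [set x : n.-tuple R | forall i, tnth x i \in `[-1, 1]].
have mbox n : measurable (box n).
  rewrite (_ : box n = \bigcap_(i in [set: 'I_n]) ((fun x => tnth x i) @^-1` `[-1, 1])).
    apply: (@fin_bigcap_measurable _ _ _ setT (fun i : 'I_n =>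
      (fun x : n.-tuple R => tnth x i) @^-1` `[-1, 1])) => [|i _].
      exact: finite_finset.
    rewrite -[X in measurable X]setTI; apply: measurable_tnth => //.
  by apply/seteqP; split => [x bx i _|x bx i]; exact: bx.
have itv_lty : (lebesgue_measure (`[(-1)%R, 1%R] : set R) < +oo)%E.
  by rewrite lebesgue_measure_itv/=; case: ifP => // _; rewrite -EFinB ltry.
have box_lty n : (lebesgue_tuple (box n) < +oo)%E.
  elim: n => [|n IH].
    by rewrite /= diracE ltry.
  rewrite /= /pushforward (_ : _ @^-1` _ = `[-1, 1] `*` box n); last first.
    apply/seteqP; split => [[a t] /= bt|[a t] /= [a1 bt] i].
      split; first by have := bt ord0; rewrite (tnth_nth 0).
      by move=> i; have := bt (lift ord0 i); rewrite tnthS.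
    case: (unliftP ord0 i) => [j ->|->]; last by rewrite (tnth_nth 0).
    by rewrite tnthS; exact: bt.
  rewrite product_measure1E ?lte_mul_pinfty ?ge0_fin_numE ?measure_ge0 //.
  exact: mbox.
apply: le_lt_trans (box_lty d); apply: le_measure; rewrite ?inE//.
  exact: measurable_unit_ball.
move=> x /= /andP[_ x1] i; rewrite in_itv/= -ler_norml.
apply: le_trans x1; rewrite -sqrtr_sqr ler_wsqrtr// (bigD1 i)//= lerDl.
by rewrite sumr_ge0// => j _; exact: sqr_ge0.
Qed.

End measurability.

Section surface_measure.
Context {R : realType} {d : nat}.

(* The surface measure of the unit sphere S^(d-1), as a measure on R^d
   supported on S^(d-1): the mass of A is d times the Lebesgue measure of the
   cone {s w | 0 < s <= 1, w in A, |w| = 1}. For d = 1 it is the counting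
   measure on {-1, 1}. *)
Definition surface_measure (A : set (d.-tuple R)) : \bar R :=
  (d%:R%:E * lebesgue_tuple
    [set x : d.-tuple R | (0 < enorm x <= 1)%R /\ A (tscale (enorm x)^-1 x)])%E.

Let M : {measure set (d.-tuple R) -> \bar R} := mscale (d%:R)%:nng
  (measure_function_pushforward__canonical__measure_function_Measure
    (mrestr (@lebesgue_tuple R d) (@measurable_unit_ball R d))
    (@measurable_normalize R d)).

Let surfaceE : surface_measure = M.
Proof.
apply/funext => A; congr (_ * lebesgue_tuple _)%E.
by apply/seteqP; split => x [].
Qed.

Let surface0 : surface_measure set0 = 0%E.
Proof. by rewrite surfaceE measure0. Qed.

Let surface_ge0 A : (0 <= surface_measure A)%E.
Proof. by rewrite surfaceE measure_ge0. Qed.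

Let surface_sigma_additive : semi_sigma_additive surface_measure.
Proof. by rewrite surfaceE; exact: measure_semi_sigma_additive. Qed.

HB.instance Definition _ := isMeasure.Build _ _ _ surface_measure
  surface0 surface_ge0 surface_sigma_additive.

Let surface_finite : fin_num_fun surface_measure.
Proof.
apply: lty_fin_num_fun; rewrite /surface_measure lte_mul_pinfty ?lee_fin//.
rewrite (_ : mkset _ = [set x | 0 < enorm x <= 1]).
  exact: lebesgue_tuple_ball_lty.
by apply/seteqP; split => x //= -[].
Qed.

HB.instance Definition _ := Measure_isFinite.Build _ _ _ surface_measure
  surface_finite.

End surface_measure.

Section lift.
Context {R : realType} {d : nat}.

(* In polar coordinates x = r w: the integral covers r > 0, and an atom of mu at
   0 becomes an atom at the origin. *)
Definition lift (mu : set (measurableTypeR R) -> \bar R)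
    (A : set (d.-tuple R)) : \bar R :=
  (\int[mu]_(r in `]0%R, +oo[) surface_measure (tscale r @^-1` A)
   + (2^-1)%:E * surface_measure [set: d.-tuple R] * mu [set 0%R] * \d_(@tzero R d) A)%E.


Context (mu : {measure set (measurableTypeR R) -> \bar R}).

Let P : {measure set (measurableTypeR R * d.-tuple R) -> \bar R} :=
  (mu \x surface_measure)%E.

Let mpolar : measurable_fun setT
  (fun p : measurableTypeR R * d.-tuple R => tscale p.1 p.2).
Proof.
have mid : measurable_fun [set: measurableTypeR R] (idfun : _ -> R).
  by move=> _ A mA; rewrite setTI.
apply: measurable_tscale; last exact: measurable_snd.
exact: (measurableT_comp mid (@measurable_fst _ _ _ (d.-tuple R))).
Qed.

Let mpos : measurable ((`]0%R, +oo[ : set (measurableTypeR R)) `*` [set: d.-tuple R]).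
Proof. by apply: measurableX => //; exact: measurable_itv. Qed.

Let morg : measurable ([set 0%R : measurableTypeR R] `*` [set: d.-tuple R]).
Proof. by apply: measurableX. Qed.

Let Mpos : {measure set (d.-tuple R) -> \bar R} :=
  measure_function_pushforward__canonical__measure_function_Measure
    (mrestr P mpos) mpolar.

Let Morg : {measure set (d.-tuple R) -> \bar R} := mscale (2^-1)%:nng
  (measure_function_pushforward__canonical__measure_function_Measure
    (mrestr P morg) (@measurable_cst _ _ _ _ setT (@tzero R d))).

Let liftE : lift mu = measure_add Mpos Morg.
Proof.
apply/funext => A; rewrite measure_addE; congr (_ + _)%E.
  rewrite integral_mkcond; apply: eq_integral => r _ /=.
  rewrite /patch; case: ifPn => r0.
    congr surface_measure; apply/seteqP; split => x /=; rewrite /xsection/= inE.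
      by move=> Ax; split => //; split => //; rewrite inE in r0.
    by move=> -[].
  rewrite (_ : xsection _ _ = set0) ?measure0//.
  apply/seteqP; split => x //=; rewrite /xsection/= inE => -[_ [/= rpos _]].
  by move: r0; rewrite notin_setE.
rewrite diracE -[X in (X * _)%E]muleA -muleA; congr (_ * _)%E.
have PE : P ([set 0%R : measurableTypeR R] `*` [set: d.-tuple R]) =
    (surface_measure [set: d.-tuple R] * mu [set 0%R])%E.
  by rewrite /P/= product_measure1E// muleC.
rewrite -PE /= /pushforward /mrestr preimage_cst.
by case: ifPn => _; rewrite ?setTI ?mule1// set0I mule0 measure0.
Qed.

Let lift0 : lift mu set0 = 0%E.
Proof. by rewrite liftE; exact: measure0. Qed.

Let lift_ge0 A : (0 <= lift mu A)%E.
Proof. by rewrite liftE; exact: measure_ge0. Qed.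

Let lift_sigma_additive : semi_sigma_additive (lift mu).
Proof. by rewrite liftE; exact: measure_semi_sigma_additive. Qed.

HB.instance Definition _ := isMeasure.Build _ _ _ (lift mu)
  lift0 lift_ge0 lift_sigma_additive.

End lift.

Section measure_hypotheses.
Context {R : realType}.
Implicit Types mu : set (measurableTypeR R) -> \bar R.

Definition locally_finite mu :=
  forall x : R, exists U : set R, [/\ open U, U x & (mu U < +oo)%E].

Definition even_measure mu :=
  forall A : set R, measurable A -> mu [set - x | x in A] = mu A.

End measure_hypotheses.

Section functions.
Context {R : realType} {d : nat}.
Implicit Types (F : 'rV[R[i]]_d -> R[i]) (f : d.-tuple R -> R).

(* R[i]^o is R[i] seen as a normed space over itself, so differentiability here
   is complex (Frechet) differentiability. *)
Definition entire F := forall z, differentiable (F : _ -> R[i]^o) z.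

Definition real_on_reals F :=
  forall x : d.-tuple R, complex.Im (F (cembed x)) = 0.

Definition restr_reals F (x : d.-tuple R) : R := complex.Re (F (cembed x)).

Definition dual_norm (z : 'rV[R[i]]_d) : R :=
  sup [set Normc.normc (\sum_(i < d) z 0 i * (tnth t i)%:C)
       | t in [set t : d.-tuple R | enorm t <= 1]].

(* [lne 0] is -oo, so zeros of F do not contribute to the limsup. *)
Definition exp_type F : \bar R :=
  @limf_esup _ 'rV[R[i]^o]_d R
    (fun z : 'rV[R[i]]_d => ((dual_norm z)^-1)%:E * lne (Normc.normc (F z))%:E)%E
    (filter_from [set: R] (fun M => [set z : 'rV[R[i]]_d | M < dual_norm z])).

Definition exp_type_at_most (delta : R) F :=
  (forall z, F z = 0) \/ (exp_type F <= delta%:E)%E.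

Definition eventually_nonneg f :=
  exists r : R, forall x, r <= enorm x -> 0 <= f x.

Definition last_sign_change f : R :=
  inf [set r : R | 0 < r /\ forall x, r <= enorm x -> 0 <= f x].

End functions.

Section extremal_problem.
Context {R : realType}.
Variables (mu : set (measurableTypeR R) -> \bar R) (delta : R) (d : nat).

Definition admissible (F : 'rV[R[i]]_d -> R[i]) :=
  [/\ entire F /\ real_on_reals F,
      exp_type_at_most delta F,
      (lift mu).-integrable setT (EFin \o restr_reals F),
      (\int[lift mu]_x (restr_reals F x)%:E <= 0)%E &
      eventually_nonneg (restr_reals F)].

(* The infimum is taken in \bar R, so it is +oo when there is no F. *)
Definition extremal_radius : \bar R :=
  ereal_inf [set (last_sign_change (restr_reals F))%:E
             | F in [set F | admissible F /\ exists z, F z != 0]].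

End extremal_problem.

(* Main.v *)
Require Import Defs.
From HB Require Import structures.
From mathcomp Require Import all_boot all_order all_algebra.
From mathcomp Require Import complex ring lra.
From mathcomp Require Import all_classical all_reals all_analysis.
From mathcomp Require Import measurable_realfun.
Set Implicit Arguments.
Unset Strict Implicit.
Unset Printing Implicit Defensive.
Import Order.TTheory GRing.Theory Num.Theory.
Import numFieldNormedType.Exports.
Local Open Scope classical_set_scope.
Local Open Scope ring_scope.
Local Open Scope complex_scope.

(** If F on C^d is admissible, then in polar coordinates the integral of F
against the lift of mu is half the integral over the sphere of
w |-> int F(r w) dmu(r), so this function of w is nonpositive somewhere; as the
real zero set of F is a null set, w can be chosen so that the slice z |-> F(z w)
is not identically zero, and this slice is admissible in dimension 1.

Conversely, if F on C is admissible, then F(z) + F(-z) is even, hence equal to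
h(z^2) with h entire, and z |-> h(z_1^2 + ... + z_d^2) is admissible on C^d:
its exponential type is controlled by |z_1^2 + ... + z_d^2| <= ||z||^2.

The function theory needed is that the derivative of an entire function is
entire (hence the second-order expansion giving h at 0) and the identity theorem.
Goursat's theorem applied to the 2 pi i-periodic function
(f(w + e^u) - f(w)) e^(-u) on a rectangle of height 2 pi yields
f'(w) = (1 / 2 pi) int (f(w + r e^(it)) - f(w)) / (r e^(it)) dt for every r > 0,
from which both follow. *)

(** * Modulus of complex numbers and bisection *)

(** No contour integral is formed: an integral over a path appears as the increment of a primitive
    [P] with [rder P t (g t)], and [mean_value_le] serves as the length-times-maximum bound. The
    compactness arguments (that bound, Goursat, boundedness on discs, finiteness of mu on bounded
    intervals) are all instances of [bisection_principle].

    Evenness of mu allows signed radii: integrating over full lines and over the whole sphere counts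
    every point twice, which gives exactly twice the lift, atom at 0 included. Both constructions
    respect |x| (|r w| = |r| on a slice, and the radial extension depends on |x| only), so neither
    increases the last sign change, and the two infima bound each other.

    Symmetrizing might annihilate F, as it does any odd function. Eventual non-negativity prevents
    this: F(r) and F(-r) would be opposite and both non-negative for large r, so F would vanish on a
    half-line. *)

Local Notation nm := Normc.normc.

Section modulus.
Context {R : realType}.
Implicit Types (x y z : R[i]) (r : R).

Lemma nm_ge0 z : 0 <= nm z.
Proof. by case: z => a b; exact: sqrtr_ge0. Qed.

Lemma nmD x y : nm (x + y) <= nm x + nm y.
Proof. exact: (@le_normcD R x y). Qed.

Lemma nmN x : nm (- x) = nm x.
Proof. exact: (@normcN R x). Qed.

Lemma nmB x y : nm (x - y) <= nm x + nm y.
Proof. by rewrite -[nm y]nmN nmD. Qed.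

Lemma nmM x y : nm (x * y) = nm x * nm y.
Proof. exact: Normc.normcM. Qed.

Lemma nm_eq0 z : (nm z == 0) = (z == 0).
Proof.
by apply/eqP/eqP => [/Normc.eq0_normc//|->]; exact: Normc.normc0.
Qed.

Lemma nm_gt0 z : (0 < nm z) = (z != 0).
Proof. by rewrite lt_def nm_ge0 nm_eq0 andbT. Qed.

Lemma nmX z n : nm (z ^+ n) = nm z ^+ n.
Proof.
elim: n => [|n IH]; first by rewrite !expr0 (@Normc.normc1 R).
by rewrite !exprS nmM IH.
Qed.

Lemma nmR r : nm r%:C = `|r|.
Proof. by rewrite /= expr0n/= addr0 sqrtr_sqr. Qed.

Lemma nmi : nm ('i%C : R[i]) = 1.
Proof. by rewrite /= expr0n/= add0r expr1n sqrtr1. Qed.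

Lemma nm_Re z : `|complex.Re z| <= nm z.
Proof.
by case: z => a b /=; rewrite -sqrtr_sqr ler_wsqrtr// lerDl sqr_ge0.
Qed.

Lemma nm_Im z : `|complex.Im z| <= nm z.
Proof.
by case: z => a b /=; rewrite -sqrtr_sqr ler_wsqrtr// lerDr sqr_ge0.
Qed.

Lemma nm_le_ReIm z : nm z <= `|complex.Re z| + `|complex.Im z|.
Proof.
rewrite {1}[z]complexE; apply: le_trans (nmD _ _) _.
by rewrite nmM nmi mul1r !nmR.
Qed.

Lemma nm_sum (I : Type) (s : seq I) (P : pred I) (F : I -> R[i]) :
  nm (\sum_(i <- s | P i) F i) <= \sum_(i <- s | P i) nm (F i).
Proof.
elim/big_rec2 : _ => [|i y1 y2 _ h]; first by rewrite Normc.normc0.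
by apply: le_trans (nmD _ _) _; rewrite lerD2l.
Qed.

Lemma nm_le_eps z : (forall e, 0 < e -> nm z <= e) -> z = 0.
Proof.
move=> h; apply/eqP; rewrite -nm_eq0 eq_le nm_ge0 andbT.
by apply/ler_addgt0Pl => e e0; rewrite addr0 h.
Qed.

Lemma normC_nm z : `|z| = (nm z)%:C.
Proof. by case: z. Qed.

End modulus.

Section bisection.
Context {R : realType}.
Variables (A : R -> R -> R -> Prop) (L H : R).
Hypotheses (L0 : 0 <= L) (H0 : 0 <= H).
Hypothesis split4 : forall x y s, 0 < s ->
  A x y (s / 2) -> A (x + s / 2 * L) y (s / 2) ->
  A x (y + s / 2 * H) (s / 2) -> A (x + s / 2 * L) (y + s / 2 * H) (s / 2) ->
  A x y s.

(** Selects a quarter of the box on which [A] fails. The last branch is a default; failure there is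
    forced by [split4]. *)
Let next (p : R * R) s : R * R :=
  if `[< ~ A p.1 p.2 (s / 2) >] then p else
  if `[< ~ A (p.1 + s / 2 * L) p.2 (s / 2) >] then (p.1 + s / 2 * L, p.2) else
  if `[< ~ A p.1 (p.2 + s / 2 * H) (s / 2) >] then (p.1, p.2 + s / 2 * H) else
  (p.1 + s / 2 * L, p.2 + s / 2 * H).

Let nextN p s : 0 < s -> ~ A p.1 p.2 s -> ~ A (next p s).1 (next p s).2 (s / 2).
Proof.
move=> s0 nA; rewrite /next; case: asboolP => // /contrapT A1.
case: asboolP => // /contrapT A2; case: asboolP => // /contrapT A3 A4.
exact/nA/split4.
Qed.

Let next_bnd p s : 0 < s ->
  [/\ p.1 <= (next p s).1, (next p s).1 + s / 2 * L <= p.1 + s * L,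
      p.2 <= (next p s).2 & (next p s).2 + s / 2 * H <= p.2 + s * H].
Proof.
move=> s0; have sL : 0 <= s / 2 * L by rewrite mulr_ge0// divr_ge0// ltW.
have sH : 0 <= s / 2 * H by rewrite mulr_ge0// divr_ge0// ltW.
have e1 : s * L = s / 2 * L + s / 2 * L by field.
have e2 : s * H = s / 2 * H + s / 2 * H by field.
rewrite /next; do ?[case: ifP => _]; split => /=; lra.
Qed.

(** If [A] failed on the initial box, repeated quartering would produce nested failing boxes with a
    common point (p, q), and the local hypothesis at that point refutes the failure once the scale
    drops below [d]. Taking [H = 0] gives bisection of an interval. *)
Lemma bisection_principle x0 y0 s0 : 0 < s0 ->
  (forall p q, x0 <= p <= x0 + s0 * L -> y0 <= q <= y0 + s0 * H ->
    exists2 d, 0 < d & forall x y s, 0 < s < d ->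
      x <= p <= x + s * L -> y <= q <= y + s * H -> A x y s) ->
  A x0 y0 s0.
Proof.
move=> s00 loc; apply: contrapT => nA.
pose sc n := s0 / 2 ^+ n.
have scS n : sc n.+1 = sc n / 2 by rewrite /sc exprSr invfM mulrA.
have sc0 n : 0 < sc n by rewrite divr_gt0// exprn_gt0.
pose u := fix u n := if n is m.+1 then next (u m) (sc m) else (x0, y0).
have uS n : u n.+1 = next (u n) (sc n) by [].
have uN n : ~ A (u n).1 (u n).2 (sc n).
  elim: n => [|n IH]; first by rewrite /sc expr0 divr1.
  by rewrite uS scS; apply: nextN.
have ub n := next_bnd (u n) (sc0 n).
have mono k n : [/\ (u n).1 <= (u (k + n)%N).1,
   (u (k + n)%N).1 + sc (k + n)%N * L <= (u n).1 + sc n * L,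
   (u n).2 <= (u (k + n)%N).2 &
   (u (k + n)%N).2 + sc (k + n)%N * H <= (u n).2 + sc n * H].
  elim: k => [|k [a b c e]]; first by rewrite add0n.
  rewrite addSn uS scS; have [a' b' c' e'] := ub (k + n)%N.
  by split; [exact: le_trans a'|exact: le_trans b' _
            |exact: le_trans c'|exact: le_trans e' _].
have limit (v : nat -> R) (K : R) : 0 <= K ->
    (forall k n, v n <= v (k + n)%N) ->
    (forall k n, v (k + n)%N + sc (k + n)%N * K <= v n + sc n * K) ->
  exists p, forall n, v n <= p <= v n + sc n * K.
  move=> K0 m1 m2; pose E := [set v n | n in [set: nat]].
  have ubE n : ubound E (v n + sc n * K).
    move=> _ [m _ <-]; have [mn|nm] := leqP m n.
      apply: le_trans (_ : v n <= _); first by rewrite -(subnK mn).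
      by rewrite lerDl mulr_ge0// ltW.
    have := m2 (m - n)%N n; rewrite subnK ?(ltnW nm)// => h.
    by apply: le_trans h; rewrite lerDl mulr_ge0// ltW.
  have E0 : E !=set0 by exists (v 0%N), 0%N.
  exists (sup E) => n; apply/andP; split.
    by apply: ub_le_sup; [exists (v 0%N + sc 0%N * K); exact: ubE|exists n].
  by apply: ge_sup => //; exact: ubE.
have [p hp] : exists p, forall n, (u n).1 <= p <= (u n).1 + sc n * L.
  by apply: (limit (fun n => (u n).1)) => // k n; have [] := mono k n.
have [q hq] : exists q, forall n, (u n).2 <= q <= (u n).2 + sc n * H.
  by apply: (limit (fun n => (u n).2)) => // k n; have [] := mono k n.
have [||d d0 hd] := loc p q.
- by have := hp 0%N; rewrite /sc expr0 divr1.
- by have := hq 0%N; rewrite /sc expr0 divr1.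
have [n sn] : exists n, sc n < d.
  exists (Num.truncn (s0 / d)).+1; rewrite /sc ltr_pdivrMr ?exprn_gt0//.
  rewrite mulrC -ltr_pdivrMr//; apply: lt_trans (truncnS_gt _) _.
  by rewrite -natrX ltr_nat ltn_expl.
by apply: (uN n); apply: hd => //; rewrite sc0.
Qed.

End bisection.

(** * Complex derivatives *)

(** Multiplying the difference quotient by [h] makes [h = 0] harmless and leaves inequalities that
    can be added and composed directly. The field is generic because both R and C are needed. *)
Lemma is_derive_normP (K : numFieldType) (f : K^o -> K^o) (z l : K^o) :
  is_derive z (1 : K^o) f l <-> forall e : K, 0 < e -> exists2 d, 0 < d &
    forall h : K, `|h| < d -> `|f (z + h) - f z - l * h| <= e * `|h|.
Proof.
pose q := fun h : K^o => h^-1 *: ((f \o shift z) (h *: (1 : K^o)) - f z).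
have E (h : K) : h != 0 -> `|l - q h| = `|f (z + h) - f z - l * h| / `|h|.
  move=> h0; rewrite /q/= -normf_div -normrN; congr `|_|.
  by rewrite /GRing.scale/= mulr1 [h + z]addrC; field.
split=> [[fd fl]|fl].
  move=> e e0; have : q @ (0 : K^o)^' --> (l : K^o) by rewrite -fl; exact: fd.
  move=> /cvgrPdist_le /(_ e e0) [d /= d0 hd]; exists d => // h hr.
  have [->|h0] := eqVneq h 0.
    by rewrite addr0 subrr mulr0 subr0 normr0 mulr0.
  have := hd h; rewrite /= sub0r normrN => /(_ hr h0).
  by rewrite E// ler_pdivrMr ?normr_gt0.
suff h : q @ (0 : K^o)^' --> (l : K^o).
  apply: DeriveDef; first by apply/cvg_ex; exists l.
  exact: cvg_lim h.
apply/cvgrPdist_le => e e0; have [d d0 hd] := fl e e0.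
exists d => // h /=; rewrite sub0r normrN => hh h0.
by rewrite E// ler_pdivrMr ?normr_gt0// hd.
Qed.


Section derivative.
Context {R : realType}.
Implicit Types (f g : R[i] -> R[i]) (z l m : R[i]).

(** The map [i] is the identity for complex derivatives and the embedding of R into C for
    derivatives along a real parameter, so that the rules of calculus are proved once for both. *)
Definition der_along (D : zmodType) (i : D -> R[i]) (g : D -> R[i]) x m :=
  forall e : R, 0 < e -> exists2 d, 0 < d &
    forall h, nm (i h) < d -> nm (g (x + h) - g x - m * i h) <= e * nm (i h).

Definition cder f z l := der_along id f z l.
Definition rder (g : R -> R[i]) x l := der_along (fun t => t%:C) g x l.

Section der_along.
Variables (D : zmodType) (i : D -> R[i]).
Local Notation der := (der_along i).

Lemma der_ext (g k : D -> R[i]) x m : g =1 k -> der g x m -> der k x m.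
Proof. by move=> /funext ->. Qed.

Lemma der_eq (g : D -> R[i]) x l m : l = m -> der g x l -> der g x m.
Proof. by move=> ->. Qed.

Lemma der_lip (g : D -> R[i]) x m : der g x m ->
  exists2 d : R, 0 < d &
    forall h, nm (i h) < d -> nm (g (x + h) - g x) <= (nm m + 1) * nm (i h).
Proof.
move=> gm; have [d d0 hd] := gm 1 ltr01; exists d => // h /hd H.
rewrite -[g _ - _](subrK (m * i h)); apply: le_trans (nmD _ _) _.
by rewrite nmM mulrDl addrC lerD2l.
Qed.

Lemma der_cont (g : D -> R[i]) x m : der g x m ->
  forall e, 0 < e -> exists2 d : R, 0 < d &
    forall h, nm (i h) < d -> nm (g (x + h) - g x) <= e.
Proof.
move=> /der_lip[d d0 hd] e e0.
have m0 : 0 < nm m + 1 by rewrite ltr_wpDl ?nm_ge0.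
exists (Num.min d (e / (nm m + 1))) => [|h]; first by rewrite lt_min d0 divr_gt0.
rewrite lt_min => /andP[/hd h1 h2]; apply: le_trans h1 _.
by rewrite mulrC -ler_pdivlMr// ltW.
Qed.

Lemma der_cst c x : der (fun=> c) x 0.
Proof.
move=> e e0; exists 1 => // h _.
by rewrite subrr mul0r subrr Normc.normc0 mulr_ge0 ?nm_ge0// ltW.
Qed.

Lemma derD (g k : D -> R[i]) x l m : der g x l -> der k x m ->
  der (fun t => g t + k t) x (l + m).
Proof.
move=> gl km e e0; have e2 : 0 < e / 2 by rewrite divr_gt0.
have [d1 d10 h1] := gl _ e2; have [d2 d20 h2] := km _ e2.
exists (Num.min d1 d2) => [|h]; first by rewrite lt_min d10.
rewrite lt_min => /andP[/h1 a /h2 b].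
rewrite (_ : _ - _ = (g (x + h) - g x - l * i h) + (k (x + h) - k x - m * i h)).
  by apply: le_trans (nmD _ _) _; lra.
by ring.
Qed.

Lemma der_comp f (g : D -> R[i]) x l m : cder f (g x) l -> der g x m ->
  der (fun t => f (g t)) x (l * m).
Proof.
move=> fl gm e e0.
have m0 : 0 < nm m + 1 by rewrite ltr_wpDl ?nm_ge0.
have l0 : 0 < nm l + 1 by rewrite ltr_wpDl ?nm_ge0.
have [d1 d10 h1] := fl (e / 2 / (nm m + 1)) (divr_gt0 (divr_gt0 e0 (ltr0Sn R 1)) m0).
have [d2 d20 h2] := gm (e / 2 / (nm l + 1)) (divr_gt0 (divr_gt0 e0 (ltr0Sn R 1)) l0).
have [d3 d30 h3] := der_lip gm.
have [d4 d40 h4] := der_cont gm (divr_gt0 d10 (ltr0Sn R 1)).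
exists (Num.min (Num.min d2 d3) d4) => [|h]; first by rewrite !lt_min d20 d30.
rewrite !lt_min => /andP[/andP[/h2 {}h2 /h3 {}h3] /h4 {}h4].
set k := g (x + h) - g x.
have kd : nm k < d1 by apply: le_lt_trans h4 _; rewrite ltr_pdivrMr//; lra.
have {}h1 := h1 _ kd; rewrite (_ : g x + k = g (x + h)) in h1; last first.
  by rewrite /k addrC subrK.
rewrite (_ : _ - _ = (f (g (x + h)) - f (g x) - l * k) + l * (k - m * i h)); last by ring.
apply: le_trans (nmD _ _) _; rewrite nmM.
have A : nm (f (g (x + h)) - f (g x) - l * k) <= e / 2 * nm (i h).
  apply: le_trans h1 _; rewrite -[leLHS]mulrA ler_wpM2l ?divr_ge0 ?(ltW e0)//.
  by rewrite ler_pdivrMl.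
have B : nm l * nm (k - m * i h) <= e / 2 * nm (i h).
  apply: le_trans (_ : (nm l + 1) * (e / 2 / (nm l + 1) * nm (i h)) <= _).
    by rewrite ler_pM ?nm_ge0 ?lerDl ?h2.
  by rewrite le_eqVlt; apply/orP; left; apply/eqP; field; rewrite gt_eqF.
lra.
Qed.

End der_along.

Lemma cder_id z : cder id z 1.
Proof.
move=> e e0; exists 1 => // h _.
by rewrite mul1r [z + h]addrC addrK subrr Normc.normc0 mulr_ge0 ?nm_ge0// ltW.
Qed.

Lemma cder_scale a z : cder (fun t => a * t) z a.
Proof.
move=> e e0; exists 1 => // h _.
rewrite (_ : _ - _ = 0) ?Normc.normc0 ?mulr_ge0 ?nm_ge0// ?ltW//.
by ring.
Qed.

Lemma cder_sqr z : cder (fun t => t ^+ 2) z (2 * z).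
Proof.
move=> e e0; exists e => // h he.
rewrite (_ : _ - _ = h * h); last by ring.
by rewrite nmM ler_wpM2r ?nm_ge0// ltW.
Qed.

Lemma rder_real x : rder (fun t => t%:C) x 1.
Proof.
move=> e e0; exists 1 => // h _.
rewrite (_ : _ - _ = 0) ?Normc.normc0 ?mulr_ge0 ?nm_ge0// ?ltW//.
by rewrite rmorphD/=; ring.
Qed.

Section der_along_ring.
Variables (D : zmodType) (i : D -> R[i]).
Local Notation der := (der_along i).

Lemma derZ a (g : D -> R[i]) x m : der g x m -> der (fun t => a * g t) x (a * m).
Proof. by move=> gm; apply: (der_comp _ gm); exact: cder_scale. Qed.

Lemma derN (g : D -> R[i]) x m : der g x m -> der (fun t => - g t) x (- m).
Proof.
move=> /(derZ (-1)); rewrite mulN1r; apply: der_ext => t.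
by rewrite mulN1r.
Qed.

Lemma derB (g k : D -> R[i]) x l m : der g x l -> der k x m ->
  der (fun t => g t - k t) x (l - m).
Proof. by move=> gl /derN; exact: derD. Qed.

(* By polarization: fg = ((f + g)^2 - (f - g)^2) / 4. *)
Lemma derM (g k : D -> R[i]) x l m : der g x l -> der k x m ->
  der (fun t => g t * k t) x (l * k x + g x * m).
Proof.
move=> gl km.
have A := der_comp (g := fun t => g t + k t) (@cder_sqr _) (derD gl km).
have B := der_comp (g := fun t => g t - k t) (@cder_sqr _) (derB gl km).
have := derZ 4^-1 (derB A B).
rewrite (_ : 4^-1 * _ = l * k x + g x * m); last by field.
by apply: der_ext => t; field.
Qed.

End der_along_ring.

Lemma cder_uniq f z l m : cder f z l -> cder f z m -> l = m.
Proof.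
move=> fl fm; apply/eqP; rewrite -subr_eq0; apply/eqP.
apply: nm_le_eps => e e0; have e2 : 0 < e / 2 by rewrite divr_gt0.
have [d1 d10 h1] := fl _ e2; have [d2 d20 h2] := fm _ e2.
pose h := Num.min d1 d2 / 2.
have mn : 0 < Num.min d1 d2 by rewrite lt_min d10.
have h0 : 0 < h by rewrite divr_gt0.
have hl : nm h%:C < Num.min d1 d2.
  by rewrite nmR gtr0_norm// ltr_pdivrMr//; lra.
move: (hl); rewrite lt_min => /andP[/h1 a /h2 b].
rewrite -(@ler_pM2r _ (nm h%:C)); last by rewrite nmR gtr0_norm.
rewrite -nmM (_ : _ * _ = (f (z + h%:C) - f z - m * h%:C) -
  (f (z + h%:C) - f z - l * h%:C)); last by ring.
by apply: le_trans (nmB _ _) _; rewrite [e]splitr mulrDl addrC lerD.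
Qed.

Lemma posC (e : R[i]) : 0 < e -> exists2 r : R, 0 < r & e = r%:C.
Proof.
by case: e => a b; rewrite ltcE /= => /andP[/eqP -> a0]; exists a.
Qed.

Lemma cderP f z l :
  cder f z l <-> is_derive (z : R[i]^o) (1 : R[i]^o) (f : R[i]^o -> R[i]^o) l.
Proof.
split=> [fl|/(is_derive_normP (K := R[i])) fl e e0].
  apply/(is_derive_normP (K := R[i])) => e /posC[r r0 ->].
  have [d d0 hd] := fl r r0; exists d%:C; first by rewrite ltcR.
  by move=> h; rewrite !normC_nm ltcR => /hd; rewrite -rmorphM lecR.
have [|d /posC[r r0 ->] hd] := fl e%:C; first by rewrite ltcR.
exists r => // h hr.
by have := hd h; rewrite !normC_nm ltcR -rmorphM lecR; exact.
Qed.

(** Bisection of [a, b], with [K] enlarged by a slack [e] that is removed at the end. On a short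
    interval around a point, the increments from that point to the two ends deviate from the linear
    ones by at most [e] times their lengths, and the two lengths add up to that of the interval. *)
Lemma mean_value_le (P p : R -> R[i]) (K a b : R) : a <= b ->
  (forall x, a <= x <= b -> rder P x (p x)) ->
  (forall x, a <= x <= b -> nm (p x) <= K) -> nm (P b - P a) <= K * (b - a).
Proof.
rewrite le_eqVlt => /predU1P[->|ab] dP pK.
  by rewrite !subrr Normc.normc0 mulr0.
have ba0 : 0 < b - a by rewrite subr_gt0.
suff h e : 0 < e -> nm (P b - P a) <= (K + e) * (b - a).
  apply/ler_addgt0Pl => e e0.
  have := h (e / (b - a)) (divr_gt0 e0 ba0); rewrite mulrDl divfK ?gt_eqF//.
  by rewrite [e + _]addrC.
move=> e0.
pose A x (y : R) s := nm (P (x + s) - P x) <= (K + e) * s.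
have abE : a + (b - a) = b by rewrite addrC subrK.
suff : A a 0 (b - a) by rewrite /A abE.
apply: (@bisection_principle R A 1 0) => //.
- move=> x y s s0; rewrite /A mulr1 => a1 a2 _ _.
  have E : x + s = x + s / 2 + s / 2 by field.
  rewrite E (_ : _ - _ = (P (x + s / 2 + s / 2) - P (x + s / 2)) +
    (P (x + s / 2) - P x)); last by ring.
  apply: le_trans (nmD _ _) _.
  by rewrite (_ : _ * s = (K + e) * (s / 2) + (K + e) * (s / 2)) ?lerD//; field.
- move=> p0 q; rewrite mulr1 abE => pab _.
  have [d d0 hd] := dP _ pab _ e0.
  exists d => // x y s /andP[s0 sd]; rewrite mulr1 => /andP[xp ps] _.
  have H1 := hd (x + s - p0); rewrite !nmR ger0_norm ?subr_ge0// in H1.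
  have H2 := hd (x - p0); rewrite !nmR ler0_norm ?subr_le0// opprB in H2.
  have E1 : p0 + (x + s - p0) = x + s by ring.
  have E2 : p0 + (x - p0) = x by ring.
  rewrite E1 in H1; rewrite E2 in H2.
  have {}H1 := H1 ltac:(lra); have {}H2 := H2 ltac:(lra).
  rewrite /A (_ : _ - _ = (P (x + s) - P p0 - p p0 * (x + s - p0)%:C)
    - (P x - P p0 - p p0 * (x - p0)%:C) + p p0 * s%:C); last first.
    by rewrite !rmorphB !rmorphD/=; ring.
  apply: le_trans (nmD _ _) _; rewrite nmM nmR gtr0_norm//.
  have := nmB (P (x + s) - P p0 - p p0 * (x + s - p0)%:C)
    (P x - P p0 - p p0 * (x - p0)%:C).
  have : nm (p p0) * s <= K * s by rewrite ler_wpM2r ?pK// ltW.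
  lra.
Qed.

End derivative.

(** * Primitives of continuous functions of a real variable *)

Section primitive.
Context {R : realType}.

(** The fundamental theorem of calculus is applied with a base point to the left of the variable, so
    a primitive on the whole line needs a base [m x] that moves with [x]. Subtracting the integral
    up to 0 makes the value independent of the base ([PE]). *)
Lemma continuous_primitive (g : R -> R) : continuous g ->
  exists P : R -> R, forall x, is_derive (x : R^o) (1 : R^o) (P : R^o -> R^o) (g x).
Proof.
move=> cg.
pose F m x : R := (\int[lebesgue_measure]_(t in `[m, x]) g t)%R.
have ig m x : lebesgue_measure.-integrable `[m, x] (EFin \o g).
  apply: continuous_compact_integrable; first exact: segment_compact.
  exact: continuous_subspaceT.
have FD M m x : M <= m -> m <= x -> F M x = F M m + F m x.
  move=> Mm mx; apply/eqP; rewrite addrC -subr_eq; apply/eqP.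
  rewrite /F Rintegral_itvB ?bnd_simp// Rintegral_itv_obnd_cbnd//.
  apply: integrableS (ig m x) => //.
  by apply: subset_itvr; rewrite bnd_simp.
pose m x : R := Num.min x 0 - 2.
pose P x := F (m x) x - F (m x) 0.
have m_le x : m x <= x /\ m x <= 0.
  rewrite /m; split; apply: le_trans (_ : Num.min x 0 <= _);
    by rewrite ?gerBl// ge_min lexx ?orbT.
have PE M x : M <= m x -> P x = F M x - F M 0.
  move=> Mm; have [h1 h2] := m_le x.
  by rewrite (FD _ _ _ Mm h1) (FD _ _ _ Mm h2) /P; ring.
exists P => x; apply/(is_derive_normP (K := R)) => e e0.
(* A base point that is valid for all [x + h] with |h| < 1 at once, so that near [x] the increments
   of [P] are those of the single function [F M]. *)
pose M := m x - 1.
have Mx : M < x by have [h1 h2] := m_le x; rewrite /M; lra.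
have [|dF EF] := @continuous_FTC1_closed R g M x (x + 1) _ (ig _ _) Mx (cg x).
  by rewrite ltrDl.
have : is_derive (x : R^o) (1 : R^o) (F M : R^o -> R^o) (g x).
  by apply: DeriveDef => //; rewrite -derive1E.
move=> /(is_derive_normP (K := R)) /(_ e e0) [d d0 hd].
exists (Num.min d 1) => [|h]; first by rewrite lt_min d0 ltr01.
rewrite lt_min => /andP[hd1]; rewrite ltr_norml => /andP[h1 h2].
have M1 : M <= m x by rewrite /M; lra.
have M2 : M <= m (x + h).
  have : Num.min x 0 - 1 <= Num.min (x + h) 0.
    rewrite le_min; apply/andP; split.
      have : Num.min x 0 <= x by rewrite ge_min lexx.
      by lra.
    have : Num.min x 0 <= 0 by rewrite ge_min lexx orbT.
    by lra.
  by rewrite /M /m; lra.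
rewrite (PE _ _ M1) (PE _ _ M2) (_ : _ - _ = F M (x + h) - F M x - g x * h).
  exact: hd.
by ring.
Qed.

Definition rcontinuous (g : R -> R[i]) := forall x e, 0 < e ->
  exists2 d, 0 < d & forall h, `|h| < d -> nm (g (x + h) - g x) <= e.

Lemma rder_continuous g : (forall x, exists l, rder g x l) -> rcontinuous g.
Proof.
move=> dg x e e0; have [l gl] := dg x.
have [d d0 hd] := der_cont gl e0; exists d => // h hh.
by apply: hd; rewrite nmR.
Qed.

Lemma rder_primitive g : rcontinuous g -> exists P, forall x, rder P x (g x).
Proof.
move=> cg.
have [|P HP] := @continuous_primitive (fun x => complex.Re (g x)).
  move=> x; apply/cvgrPdist_le => e e0; have [d d0 hd] := cg x e e0.
  exists d => //= y; rewrite /= -normrN opprB => /hd.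
  rewrite (_ : x + (y - x) = y) => [/(le_trans (nm_Re _))|]; last by ring.
  by rewrite raddfB -normrN opprB.
have [|Q HQ] := @continuous_primitive (fun x => complex.Im (g x)).
  move=> x; apply/cvgrPdist_le => e e0; have [d d0 hd] := cg x e e0.
  exists d => //= y; rewrite /= -normrN opprB => /hd.
  rewrite (_ : x + (y - x) = y) => [/(le_trans (nm_Im _))|]; last by ring.
  by rewrite raddfB -normrN opprB.
exists (fun x => (P x +i* Q x)%C) => x e e0.
have e2 : 0 < e / 2 by rewrite divr_gt0.
have /(is_derive_normP (K := R)) /(_ _ e2) [d1 d10 h1] := HP x.
have /(is_derive_normP (K := R)) /(_ _ e2) [d2 d20 h2] := HQ x.
exists (Num.min d1 d2) => [|h]; first by rewrite lt_min d10.
rewrite nmR lt_min => /andP[/h1 {}h1 /h2 {}h2].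
apply: le_trans (nm_le_ReIm _) _.
rewrite (_ : complex.Re _ = P (x + h) - P x - complex.Re (g x) * h); last first.
  by case: (g x) => a b /=; ring.
rewrite (_ : complex.Im _ = Q (x + h) - Q x - complex.Im (g x) * h); last first.
  by case: (g x) => a b /=; ring.
by lra.
Qed.

End primitive.

(** * Goursat's theorem on rectangles *)

Section goursat.
Context {R : realType}.
Implicit Types (f : R[i] -> R[i]).

Definition holo f := forall z, exists l, cder f z l.

Lemma rder_hline (c x : R) : rder (fun t => t +i* c) x 1.
Proof.
have := derD (@rder_real R x) (der_cst (fun t : R => t%:C) (0 +i* c) x).
rewrite addr0; apply: der_ext => t.
by apply/eqP; rewrite eq_complex /= addr0 add0r !eqxx.
Qed.

Lemma rder_vline (a x : R) : rder (fun t => a +i* t) x 'i%C.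
Proof.
have := derD (derZ 'i%C (@rder_real R x)) (der_cst (fun t : R => t%:C) a%:C x).
rewrite addr0 mulr1; apply: der_ext => t.
apply/eqP; rewrite eq_complex /=; apply/andP; split; apply/eqP; ring.
Qed.

Section rectangle.
Variables (f : R[i] -> R[i]) (X Y : R -> R -> R[i]).
Hypothesis hf : holo f.
Hypothesis hX : forall c t, rder (X c) t (f (t +i* c)).
Hypothesis hY : forall a t, rder (Y a) t (f (a +i* t)).

(** The contour integral of [f] around a rectangle: bottom minus top, plus i times right minus left,
    each side being an increment of a primitive. *)
Let I x x' y y' := X y x' - X y x - (X y' x' - X y' x)
   + 'i%C * (Y x' y' - Y x' y - (Y x y' - Y x y)).

(** Near z0 the function [f] is affine up to [e] times the distance. The affine part has the
    primitive [A] and contributes nothing to a closed contour; the rest is at most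
    [e * (s * (L + H))] on each side, and the perimeter is [2 * s * (L + H)]. *)
Let I_local p q (L H : R) e : 0 <= L -> 0 <= H -> 0 < e ->
  exists2 d, 0 < d & forall x y s, 0 < s < d ->
    x <= p <= x + s * L -> y <= q <= y + s * H ->
    nm (I x (x + s * L) y (y + s * H)) <= 2 * e * (s * (L + H)) ^+ 2.
Proof.
move=> L0 H0 e0; set z0 := p +i* q.
have [l fl] := hf z0; have [d d0 hd] := fl e e0.
have LH : 0 < L + H + 1 by lra.
exists (d / (L + H + 1)) => [|x y s]; first by rewrite divr_gt0.
move=> /andP[s0]; rewrite ltr_pdivlMr// => sd xp yq.
set x' := x + s * L; set y' := y + s * H.
have sL : 0 <= s * L by rewrite mulr_ge0// ltW.
have sH : 0 <= s * H by rewrite mulr_ge0// ltW.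
have xx' : x <= x' by rewrite lerDl.
have yy' : y <= y' by rewrite lerDl.
pose A z := f z0 * z + l / 2 * (z - z0) ^+ 2.
have dA z : cder A z (f z0 + l * (z - z0)).
  have D := derB (cder_id z) (der_cst id z0 z).
  apply: der_eq (derD (cder_scale (f z0) z)
    (derZ (l / 2) (der_comp (g := fun t => id t - z0) (@cder_sqr _ _) D))).
  by rewrite /= subr0 mulr1; field.
pose r z := f z - f z0 - l * (z - z0).
have rK z : x <= complex.Re z <= x' -> y <= complex.Im z <= y' ->
    nm (r z) <= e * (s * (L + H)).
  move=> hx hy; have zz : nm (z - z0) <= s * (L + H).
    apply: le_trans (nm_le_ReIm _) _; rewrite mulrDr.
    have -> : complex.Re (z - z0) = complex.Re z - p by case: (z).
    have -> : complex.Im (z - z0) = complex.Im z - q by case: (z).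
    by rewrite lerD// ler_norml; rewrite /x' /y' in hx hy xp yq *; lra.
  have zd : nm (z - z0) < d by apply: le_lt_trans zz _; lra.
  have := hd _ zd; rewrite (_ : z0 + (z - z0) = z); last by ring.
  by move=> /le_trans; apply; rewrite ler_wpM2l// ltW.
pose X' c t := X c t - A (t +i* c).
pose Y' a t := Y a t + 'i%C * A (a +i* t).
have dX c t : rder (X' c) t (r (t +i* c)).
  apply: der_eq (derB (hX c t) (der_comp (dA _) (rder_hline c t))).
  by rewrite /r; ring.
have dY a t : rder (Y' a) t (r (a +i* t)).
  apply: der_eq (derD (hY a t) (derZ 'i%C (der_comp (dA _) (rder_vline a t)))).
  rewrite mulrCA -expr2 sqr_i /r; ring.
(* Each corner value of [A] enters once from a horizontal and once from a vertical side, with total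
   factor 1 + i^2 = 0. *)
have IE : I x x' y y' = X' y x' - X' y x - (X' y' x' - X' y' x)
   + 'i%C * (Y' x' y' - Y' x' y - (Y' x y' - Y' x y)).
  apply/eqP; rewrite -subr_eq0 /I /X' /Y'; apply/eqP.
  rewrite [LHS](_ : _ = (1 + 'i%C ^+ 2) * (A (x' +i* y) - A (x +i* y) - A (x' +i* y') + A (x +i* y'))); last by ring.
  by rewrite sqr_i subrr mul0r.
have bX c : y <= c <= y' -> nm (X' c x' - X' c x) <= e * (s * (L + H)) * (s * L).
  move=> hc; apply: le_trans (mean_value_le xx' (fun t _ => dX c t) _) _ => [t ht|].
    exact: rK.
  by rewrite (_ : x' - x = s * L)// /x'; ring.
have bY a : x <= a <= x' -> nm (Y' a y' - Y' a y) <= e * (s * (L + H)) * (s * H).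
  move=> hc; apply: le_trans (mean_value_le yy' (fun t _ => dY a t) _) _ => [t ht|].
    exact: rK.
  by rewrite (_ : y' - y = s * H)// /y'; ring.
rewrite IE; apply: le_trans (nmD _ _) _; rewrite nmM nmi mul1r.
have b1 := bX y; have b2 := bX y'; have b3 := bY x; have b4 := bY x'.
rewrite !lexx !xx' !yy' /= in b1 b2 b3 b4.
have {}b1 := b1 isT; have {}b2 := b2 isT; have {}b3 := b3 isT; have {}b4 := b4 isT.
have n1 := nmB (X' y x' - X' y x) (X' y' x' - X' y' x).
have n2 := nmB (Y' x' y' - Y' x' y) (Y' x y' - Y' x y).
rewrite [leRHS](_ : _ = 2 * (e * (s * (L + H)) * (s * L)) +
  2 * (e * (s * (L + H)) * (s * H))); last by ring.
by lra.
Qed.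

(** The bisected property bounds the contour integral by [e * s ^+ 2], which scales like area: the
    interior sides cancel, and four quarters with bound [e * (s / 2) ^+ 2] add up to
    [e * s ^+ 2]. *)
Lemma goursat a c L H : 0 <= L -> 0 <= H ->
  X c (a + L) - X c a - (X (c + H) (a + L) - X (c + H) a)
   + 'i%C * (Y (a + L) (c + H) - Y (a + L) c - (Y a (c + H) - Y a c)) = 0.
Proof.
move=> L0 H0; apply: nm_le_eps => e e0.
pose A x y s := nm (I x (x + s * L) y (y + s * H)) <= e * s ^+ 2.
suff : A a c 1 by rewrite /A !mul1r expr1n mulr1.
(* Divisor for [e] that turns the bound of [I_local] into [e * s ^+ 2]; the 1 keeps it positive when
   L = H = 0. *)
have K0 : 0 < 2 * (L + H) ^+ 2 + 1 by rewrite ltr_wpDl// mulr_ge0// sqr_ge0.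
apply: (@bisection_principle R A L H) => //.
  move=> x y s s0; rewrite /A => a1 a2 a3 a4.
  set x1 := x + s / 2 * L in a1 a2 a3 a4; set y1 := y + s / 2 * H in a1 a2 a3 a4.
  have Ex : x + s * L = x1 + s / 2 * L by rewrite /x1; field.
  have Ey : y + s * H = y1 + s / 2 * H by rewrite /y1; field.
  rewrite -Ex -Ey in a2 a3 a4.
  rewrite (_ : I _ _ _ _ = (I x x1 y y1 + I x1 (x + s * L) y y1) +
    (I x x1 y1 (y + s * H) + I x1 (x + s * L) y1 (y + s * H))); last first.
    by rewrite /I; ring.
  apply: le_trans (nmD _ _) _.
  have n1 := nmD (I x x1 y y1) (I x1 (x + s * L) y y1).
  have n2 := nmD (I x x1 y1 (y + s * H)) (I x1 (x + s * L) y1 (y + s * H)).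
  by rewrite [leRHS](_ : _ = 4 * (e * (s / 2) ^+ 2)); [lra|field].
move=> p q _ _.
have [d d0 hd] := @I_local p q L H _ L0 H0 (divr_gt0 e0 K0).
exists d => // x y s sd xp yq; rewrite /A; apply: le_trans (hd _ _ _ sd xp yq) _.
rewrite [leLHS](_ : _ = e * s ^+ 2 * (2 * (L + H) ^+ 2 / (2 * (L + H) ^+ 2 + 1))).
  rewrite ler_piMr ?(mulr_ge0 (ltW e0)) ?sqr_ge0//.
  by rewrite ler_pdivrMr// mul1r lerDl.
by field; rewrite gt_eqF.
Qed.

End rectangle.
End goursat.

(** * Cauchy's formula for the derivative *)

Section cexp.
Context {R : realType}.
Implicit Types (z : R[i]) (t : R).

Definition cis t : R[i] := cos t +i* sin t.

Definition cexp z : R[i] := (expR (complex.Re z))%:C * cis (complex.Im z).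

Lemma nm_cis t : nm (cis t) = 1.
Proof. by rewrite /= cos2Dsin2 sqrtr1. Qed.

Lemma cis_neq0 t : cis t != 0.
Proof. by rewrite -nm_gt0 nm_cis. Qed.

Lemma nm_cexp z : nm (cexp z) = expR (complex.Re z).
Proof. by rewrite nmM nm_cis mulr1 nmR gtr0_norm// expR_gt0. Qed.

Lemma cexpD z w : cexp (z + w) = cexp z * cexp w.
Proof.
case: z w => [a b] [c e]; rewrite /cexp /= expRD.
rewrite /cis sinD cosD rmorphM /=.
by apply/eqP; rewrite eq_complex /=; apply/andP; split; apply/eqP; ring.
Qed.

Lemma cexp0 : cexp 0 = 1.
Proof.
by apply/eqP; rewrite eq_complex /= expR0 cos0 sin0 !mulr1 !mulr0 subr0 addr0 !eqxx.
Qed.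

Lemma cexp_period a : cexp (a +i* (2 * pi)) = cexp (a +i* 0).
Proof.
by rewrite /cexp /cis /= mulr_natl cos2pi sin2pi cos0 sin0.
Qed.

Lemma cexpN z : cexp (- z) = (cexp z)^-1.
Proof.
have n0 : cexp z != 0 by rewrite -nm_gt0 nm_cexp expR_gt0.
by apply: (mulfI n0); rewrite -cexpD subrr cexp0 divff.
Qed.

Lemma cder_cexp0 : cder cexp 0 1.
Proof.
(* The remainders of exp, cos and sin contribute [e * n] each and the product term at most
   [2n * 3n <= 6 * (e * n)], because n < e; the total 9 is rounded up to 10. *)
move=> eps eps0; pose e := Num.min eps 1 / 10.
have e0 : 0 < e by rewrite divr_gt0// lt_min eps0 ltr01.
have e1 : e <= 1 / 10 by rewrite /e ler_pM2r// ge_min lexx orbT.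
have ee : 10 * e <= eps.
  by rewrite /e mulrC divfK ?pnatr_eq0// ge_min lexx.
have /(is_derive_normP (K := R)) /(_ e e0) [d1 d10 h1] := is_derive_expR (0 : R).
have /(is_derive_normP (K := R)) /(_ e e0) [d2 d20 h2] := is_derive_cos (0 : R).
have /(is_derive_normP (K := R)) /(_ e e0) [d3 d30 h3] := is_derive_sin (0 : R).
exists (Num.min (Num.min d1 d2) (Num.min d3 e)) => [|z].
  by rewrite !lt_min d10 d20 d30.
rewrite !lt_min => /andP[/andP[n1 n2] /andP[n3 n4]].
have zx := nm_Re z; have zy := nm_Im z.
set n := nm z in n1 n2 n3 n4 zx zy *.
have n0 : 0 <= n by exact: nm_ge0.
rewrite add0r mul1r cexp0; case: z @n n1 n2 n3 n4 zx zy n0 => x y n n1 n2 n3 n4 zx zy n0.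
have {}h1 := h1 _ (le_lt_trans zx n1).
have {}h2 := h2 _ (le_lt_trans zy n2).
have {}h3 := h3 _ (le_lt_trans zy n3).
rewrite /= !add0r ?expR0 ?cos0 ?sin0 ?oppr0 ?mul0r ?subr0 ?addr0 ?mul1r in h1 h2 h3 zx zy.
rewrite (_ : _ - _ = (expR x - 1 - x)%:C + (cos y - 1)%:C + 'i%C * (sin y - y)%:C
   + (expR x - 1)%:C * ((cos y - 1)%:C + 'i%C * (sin y)%:C)); last first.
  by apply/eqP; rewrite eq_complex /=; apply/andP; split; apply/eqP; ring.
apply: le_trans (nmD _ _) _; rewrite nmM.
have t1 := nmD ((expR x - 1 - x)%:C + (cos y - 1)%:C) ('i%C * (sin y - y)%:C).
have t2 := nmD (expR x - 1 - x)%:C (cos y - 1)%:C.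
have t3 := nmD (cos y - 1)%:C ('i%C * (sin y)%:C).
rewrite !nmM !nmi !nmR !mul1r in t1 t2 t3 *.
have m1 : e * `|x| <= e * n by rewrite ler_pM2l.
have m2 : e * `|y| <= e * n by rewrite ler_pM2l.
have m3 : e * n <= n by rewrite ler_piMl//; lra.
have u1 : `|expR x - 1| <= 2 * n.
  by have := ler_normD (expR x - 1 - x) x; rewrite subrK; lra.
have u2 : `|sin y| <= 2 * n.
  by have := ler_normD (sin y - y) y; rewrite subrK; lra.
have u3 : nm ((cos y - 1)%:C + 'i%C * (sin y)%:C) <= 3 * n by lra.
have u4 : `|expR x - 1| * nm ((cos y - 1)%:C + 'i%C * (sin y)%:C) <= 6 * (e * n).
  apply: le_trans (ler_pM _ _ u1 u3) _ => //; first exact: nm_ge0.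
  rewrite [leLHS](_ : _ = 6 * (n * n)); last by ring.
  by rewrite ler_pM2l// ler_wpM2r// ltW.
have u5 : 10 * e * n <= eps * n by rewrite ler_wpM2r.
have en0 : 0 <= e * n by rewrite mulr_ge0 ?(ltW e0).
lra.
Qed.

Lemma cder_cexp z : cder cexp z (cexp z).
Proof.
move=> e e0; have z0 : 0 < nm (cexp z) by rewrite nm_cexp expR_gt0.
have [d d0 hd] := cder_cexp0 (divr_gt0 e0 z0).
exists d => // h /hd; rewrite add0r cexp0 mul1r => H.
rewrite cexpD (_ : _ - _ = cexp z * (cexp h - 1 - h)); last by ring.
by rewrite nmM -ler_pdivlMl// mulrA [_^-1 * _]mulrC.
Qed.

Section derivative_formula.
Variables (f : R[i] -> R[i]) (w l : R[i]).
Hypothesis hf : holo f.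
Hypothesis fl : cder f w l.

Let q z := (f (w + cexp z) - f w) * cexp (- z).

Let hq : holo q.
Proof.
move=> z; have [m fm] := hf (w + cexp z).
have d1 := derB (der_comp (g := fun u => w + cexp u) fm
  (derD (der_cst id w z) (cder_cexp z))) (der_cst id (f w) z).
have d2 := der_comp (g := fun u => - id u) (cder_cexp (- z)) (derN (cder_id z)).
by eexists; exact: (derM d1 d2).
Qed.

Let rq (g : R -> R[i]) : (forall t, exists l, rder g t l) ->
  exists P, forall t, rder P t (q (g t)).
Proof.
move=> dg; apply: rder_primitive; apply: rder_continuous => t.
have [m gm] := dg t; have [k qk] := hq (g t).
by exists (k * m); exact: der_comp qk gm.
Qed.

(** By Goursat and periodicity, the increment of a primitive of [q] over a vertical segment of
    height 2 pi does not depend on the abscissa. As the abscissa tends to minus infinity, e^z tends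
    to 0 and [q] tends uniformly to [l], so the increment is 2 pi l; the abscissa [ln r] gives the
    circle of radius [r]. *)
Lemma derivative_formula r : 0 < r -> exists2 Y : R -> R[i],
  (forall t, rder Y t ((f (w + r%:C * cis t) - f w) / (r%:C * cis t))) &
  Y (2 * pi) - Y 0 = (2 * pi)%:C * l.
Proof.
move=> r0.
have /choice[X hX] : forall c : R, exists P, forall t, rder P t (q (t +i* c)).
  by move=> c; apply: rq => t; exists 1; exact: rder_hline.
have /choice[Y hY] : forall a : R, exists P, forall t, rder P t (q (a +i* t)).
  by move=> c; apply: rq => t; exists 'i%C; exact: rder_vline.
have pi0 : 0 < 2 * pi :> R by rewrite mulr_gt0 ?pi_gt0.
have qper a : q (a +i* (2 * pi)) = q (a +i* 0).
  by rewrite /q !cexpN cexp_period.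
have Yconst a b : a <= b -> Y b (2 * pi) - Y b 0 = Y a (2 * pi) - Y a 0.
  move=> ab; have ba0 : 0 <= b - a by rewrite subr_ge0.
  have := goursat hq hX hY a 0 ba0 (ltW pi0).
  have -> : a + (b - a) = b by ring.
  rewrite add0r.
  (* The two horizontal sides cancel: by periodicity the difference of their primitives has
     derivative 0, so the mean value inequality with bound 0 applies. *)
  have : (X (2 * pi) b - X 0 b) - (X (2 * pi) a - X 0 a) = 0.
    apply/eqP; rewrite -nm_eq0 eq_le nm_ge0 andbT.
    have := @mean_value_le _ (fun t => X (2 * pi) t - X 0 t) (fun=> 0) 0 _ _ ab.
    rewrite mul0r; apply => [x _|x _]; last by rewrite Normc.normc0.
    by apply: der_eq (derB (hX _ _) (hX _ _)); rewrite qper subrr.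
  move=> X0 G.
  have /eqP : 'i%C * ((Y b (2 * pi) - Y b 0) - (Y a (2 * pi) - Y a 0)) = 0.
    by apply: etrans (etrans (f_equal2 +%R G X0) (addr0 0)); ring.
  rewrite mulf_eq0 => /orP[|]; first by rewrite -nm_eq0 nmi oner_eq0.
  by rewrite subr_eq0 => /eqP.
have Ylim b : Y b (2 * pi) - Y b 0 = (2 * pi)%:C * l.
  apply/eqP; rewrite -subr_eq0; apply/eqP; apply: nm_le_eps => e e0.
  have [d d0 hd] := fl (divr_gt0 e0 pi0).
  pose a := Num.min b (ln (d / 2)).
  have ab : a <= b by rewrite ge_min lexx.
  have ad : expR a < d.
    have d2 : 0 < d / 2 by rewrite divr_gt0.
    apply: le_lt_trans (_ : d / 2 < d); last by lra.
    by rewrite -[leRHS]lnK ?posrE// ler_expR ge_min lexx orbT.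
  rewrite (Yconst _ _ ab).
  have D t : rder (fun t => Y a t - l * t%:C) t (q (a +i* t) - l).
    by apply: der_eq (derB (hY a t) (derZ l (rder_real t))); rewrite mulr1.
  have := mean_value_le (ltW pi0) (fun t _ => D t) (K := e / (2 * pi)).
  rewrite subr0 divfK ?gt_eqF// mulr0 subr0.
  rewrite (_ : _ - _ - _ = Y a (2 * pi) - Y a 0 - (2 * pi)%:C * l); last by ring.
  apply => t _.
  have n0 : cexp (a +i* t) != 0 by rewrite -nm_gt0 nm_cexp expR_gt0.
  have := hd (cexp (a +i* t)); rewrite nm_cexp => /(_ ad).
  rewrite [f _ - _ - _](_ : _ = (q (a +i* t) - l) * cexp (a +i* t)).
    by rewrite nmM nm_cexp ler_pM2r ?expR_gt0.
  by rewrite /q cexpN; field.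
exists (Y (ln r)) => // t; apply: der_eq (hY _ t).
rewrite /q cexpN (_ : cexp _ = r%:C * cis t)//.
by rewrite /cexp /= lnK.
Qed.

Lemma cauchy_estimate r M : 0 < r ->
  (forall t, nm (f (w + r%:C * cis t) - f w) <= M) -> nm l <= M / r.
Proof.
move=> r0 fM; have [Y hY YE] := derivative_formula r0.
have pi0 : 0 < 2 * pi :> R by rewrite mulr_gt0 ?pi_gt0.
have := mean_value_le (ltW pi0) (fun t _ => hY t) (K := M / r).
rewrite YE nmM nmR gtr0_norm// subr0 [leRHS]mulrC ler_pM2l//; apply => t _.
by rewrite nmM Normc.normcV nmM nmR gtr0_norm// nm_cis mulr1 ler_pM2r ?invr_gt0.
Qed.

End derivative_formula.
End cexp.

(** * Regularity of entire functions of one variable *)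

Section regularity.
Context {R : realType}.
Implicit Types (f : R[i] -> R[i]) (z w h : R[i]).

Lemma holo_bounded f rho : holo f ->
  exists2 M, 0 <= M & forall z, nm z <= rho -> nm (f z) <= M.
Proof.
move=> hf; have [r0|r0] := ltP rho 0.
  by exists 0 => // z /le_lt_trans /(_ r0); rewrite ltNge nm_ge0.
pose A x y s := exists2 M : R, 0 <= M &
  forall z, x <= complex.Re z <= x + s * 1 -> y <= complex.Im z <= y + s * 1 ->
  nm (f z) <= M.
(* The extra 1 keeps the side of the square positive when [rho] is 0. *)
suff [M M0 HM] : A (- rho) (- rho) (2 * rho + 1).
  exists M => // z zr; have := nm_Re z; have := nm_Im z.
  by rewrite !ler_norml => /andP[a b] /andP[c e]; apply: HM; lra.
apply: (@bisection_principle R A 1 1) => //; last 2 first.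
- by lra.
- move=> p q _ _; have [l fl] := hf (p +i* q).
  have [d d0 hd] := der_cont fl ltr01.
  exists (d / 2) => [|x y s /andP[s0 sd]]; first by rewrite divr_gt0.
  rewrite mulr1 => xp yq; exists (nm (f (p +i* q)) + 1) => [|z].
    by rewrite addr_ge0 ?nm_ge0.
  rewrite mulr1 => zx zy; have : nm (z - (p +i* q)) < d.
    apply: le_lt_trans (nm_le_ReIm _) _.
    have -> : complex.Re (z - (p +i* q)) = complex.Re z - p by case: (z).
    have -> : complex.Im (z - (p +i* q)) = complex.Im z - q by case: (z).
    have : `|complex.Re z - p| <= s by rewrite ler_norml; lra.
    have : `|complex.Im z - q| <= s by rewrite ler_norml; lra.
    by rewrite ltr_pdivlMr// in sd; lra.
  move=> /hd; rewrite (_ : _ + (z - _) = z); last by ring.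
  have := nmD (f z - f (p +i* q)) (f (p +i* q)); rewrite subrK /=; lra.
- move=> x y s s0 [M1 M10 h1] [M2 M20 h2] [M3 M30 h3] [M4 M40 h4].
  exists (M1 + M2 + M3 + M4); first by rewrite !addr_ge0.
  move=> z; rewrite mulr1 => zx zy.
  have {h1} := h1 z; have {h2} := h2 z; have {h3} := h3 z; have {h4} := h4 z.
  rewrite !mulr1 => h4 h3 h2 h1.
  case: (leP (complex.Re z) (x + s / 2)) => hx;
    case: (leP (complex.Im z) (y + s / 2)) => hy.
  + by have := h1 ltac:(lra) ltac:(lra); lra.
  + by have := h3 ltac:(lra) ltac:(lra); lra.
  + by have := h2 ltac:(lra) ltac:(lra); lra.
  + by have := h4 ltac:(lra) ltac:(lra); lra.
Qed.

Lemma rder_line f u h l (t : R) : cder f (u + t%:C * h) l ->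
  rder (fun s : R => f (u + s%:C * h)) t (l * h).
Proof.
move=> fl; apply: (der_comp (g := fun s : R => u + s%:C * h) fl).
have := derD (der_cst (fun s : R => s%:C) u t) (derM (rder_real t) (der_cst _ h t)).
by apply: der_eq; rewrite mul1r mulr0 addr0 add0r.
Qed.

Lemma holo_shift f w : holo f -> holo (fun z => f (z + w)).
Proof.
move=> hf z; have [l fl] := hf (z + w); exists (l * (1 + 0)).
apply: (der_comp (g := fun t => t + w) fl).
exact: derD (cder_id z) (der_cst id w z).
Qed.

Lemma rcontinuousM (g k : R -> R[i]) : rcontinuous g -> rcontinuous k ->
  rcontinuous (fun t => g t * k t).
Proof.
move=> cg ck x e e0.
pose K := nm (g x) + nm (k x) + 1.
have K0 : 0 < K by rewrite ltr_wpDl ?addr_ge0 ?nm_ge0.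
pose e1 := Num.min 1 (e / K).
have e10 : 0 < e1 by rewrite lt_min ltr01 divr_gt0.
have [d1 d10 h1] := cg x e1 e10; have [d2 d20 h2] := ck x e1 e10.
exists (Num.min d1 d2) => [|h]; first by rewrite lt_min d10.
rewrite lt_min => /andP[/h1 a /h2 b].
rewrite (_ : _ - _ = (g (x + h) - g x) * (k (x + h) - k x) +
  ((g (x + h) - g x) * k x + g x * (k (x + h) - k x))); last by ring.
apply: le_trans (nmD _ _) _; apply: le_trans (lerD (lexx _) (nmD _ _)) _.
rewrite !nmM.
have u1 : e1 * K <= e by rewrite -ler_pdivlMr// /e1 ge_min lexx orbT.
apply: le_trans u1; rewrite /K 2!mulrDr mulr1.
have u2 : nm (g (x + h) - g x) * nm (k (x + h) - k x) <= e1.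
  apply: le_trans (ler_pM _ _ a b) _; rewrite ?nm_ge0//.
  by rewrite ler_piMr ?(ltW e10)// ge_min lexx.
have u3 : nm (g (x + h) - g x) * nm (k x) <= e1 * nm (k x).
  by rewrite ler_wpM2r ?nm_ge0.
have u4 : nm (g x) * nm (k (x + h) - k x) <= e1 * nm (g x).
  by rewrite mulrC ler_wpM2r ?nm_ge0.
by lra.
Qed.

Section derivative.
Variables (f f' : R[i] -> R[i]).
Hypothesis ff' : forall z, cder f z (f' z).

Let hf : holo f. Proof. by move=> z; exists (f' z). Qed.

Lemma deriv_bounded rho :
  exists2 B, 0 <= B & forall z, nm z <= rho -> nm (f' z) <= B.
Proof.
have [M M0 HM] := holo_bounded (rho + 1) hf.
exists (2 * M) => [|z zr]; first by rewrite mulr_ge0.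
rewrite -[leRHS]divr1; apply: (cauchy_estimate hf (ff' z)) => // t.
apply: le_trans (nmB _ _) _.
have -> : 2 * M = M + M by ring.
apply: lerD; apply: HM; last by lra.
apply: le_trans (nmD _ _) _; rewrite nmM nm_cis nmR normr1; lra.
Qed.

Lemma holo_lip rho : exists2 B, 0 <= B &
  forall u h, nm u <= rho -> nm h <= rho -> nm (f (u + h) - f u) <= B * nm h.
Proof.
have [B B0 HB] := deriv_bounded (rho + rho); exists B => // u h ur hr.
have := mean_value_le (@ler01 R) (fun t _ => rder_line (ff' (u + t%:C * h))) (K := B * nm h).
rewrite mul0r mul1r addr0 subr0 mulr1; apply => t /andP[t0 t1].
rewrite nmM ler_wpM2r ?nm_ge0//; apply: HB.
apply: le_trans (nmD _ _) _; rewrite nmM nmR ger0_norm//.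
by rewrite lerD// (le_trans _ hr)// ler_piMl// nm_ge0.
Qed.

(** No second derivative is available yet. Instead the Cauchy estimate is applied to the difference
    [g] of two translates of [f]: its derivative at 0 is [f' (u + h) - f' u], and its values are at
    most a constant times |h| by [holo_lip]. *)
Lemma deriv_lip rho : exists2 B, 0 <= B &
  forall u h, nm u <= rho -> nm h <= rho -> nm (f' (u + h) - f' u) <= B * nm h.
Proof.
have [r0|r0] := ltP rho 0.
  by exists 0 => // u h /le_lt_trans /(_ r0); rewrite ltNge nm_ge0.
have [B B0 HB] := holo_lip (rho + 1); exists (2 * B) => [|u h ur hr].
  by rewrite mulr_ge0.
pose g z := f (z + (u + h)) - f (z + u).
have hg : holo g.
  move=> z; have [l1 H1] := holo_shift (u + h) hf z.
  have [l2 H2] := holo_shift u hf z.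
  by exists (l1 - l2); exact: derB.
have g0 : cder g 0 (f' (u + h) - f' u).
  have sh w : cder (fun z => f (z + w)) 0 (f' w).
    have := der_comp (g := fun t => t + w) (x := 0) (ff' (0 + w))
      (derD (cder_id 0) (der_cst id w 0)).
    by rewrite add0r addr0 mulr1.
  exact: derB (sh _) (sh _).
rewrite -[leRHS]divr1; apply: (cauchy_estimate hg g0) => // t.
apply: le_trans (nmB _ _) _; rewrite /g mul1r !add0r.
have -> : 2 * B * nm h = B * nm h + B * nm h by ring.
have hr1 : nm h <= rho + 1 by lra.
apply: lerD; last by apply: HB => //; lra.
rewrite addrA; apply: HB => //; apply: le_trans (nmD _ _) _.
by rewrite nm_cis; lra.
Qed.

Lemma taylor1_le rho : exists2 B, 0 <= B &
  forall u h, nm u <= rho -> nm h <= rho ->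
  nm (f (u + h) - f u - f' u * h) <= B * nm h ^+ 2.
Proof.
have [B B0 HB] := deriv_lip rho; exists B => // u h ur hr.
have D (t : R) := derB (rder_line (ff' (u + t%:C * h)))
  (derZ (f' u * h) (rder_real t)).
have := mean_value_le (@ler01 R) (fun t _ => D t) (K := B * nm h ^+ 2).
rewrite mul0r mul1r !addr0 subr0 !mulr1 mulr0 subr0.
rewrite (_ : _ - _ - _ = f (u + h) - f u - f' u * h); last by ring.
apply => t /andP[t0 t1].
rewrite -mulrBl nmM expr2 mulrA ler_wpM2r ?nm_ge0//.
have th : nm (t%:C * h) <= nm h.
  by rewrite nmM nmR ger0_norm// ler_piMl// nm_ge0.
by apply: le_trans (HB _ _ ur (le_trans th hr)) _; rewrite ler_wpM2l.
Qed.

(** Differentiation under the integral sign in [derivative_formula] on the unit circle. The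
    candidate derivative is the mean of (f'(w + e^(it)) - f'(w)) / e^(it), and the error of the
    integrand is at most 2 B |h|^2 by [taylor1_le]. *)
Lemma holo_deriv : holo f'.
Proof.
move=> w; have [B B0 HB] := taylor1_le (nm w + 1).
have [Y hY YE] := derivative_formula hf (ff' w) (@ltr01 R).
have [L L0 HL] := deriv_lip (nm w + 2).
have w0 := nm_ge0 w.
have wc (t : R) : nm (w + 1 * cis t) <= nm w + 1.
  by apply: le_trans (nmD _ _) _; rewrite mul1r nm_cis.
have rc : rcontinuous (fun t => (f' (w + 1%:C * cis t) - f' w) / (1%:C * cis t)).
  (* Turning the quotient into a product lets continuity follow from [rcontinuousM]; continuity of
     [f'] itself comes from [deriv_lip]. *)
  rewrite (_ : (fun _ => _) = (fun t => (f' (w + 1%:C * cis t) - f' w) * cis (- t))).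
    apply: rcontinuousM; last first.
      apply: rder_continuous => t; exists (cexp (0 +i* - t) * (- 1 * 'i%C)).
      have d1 := der_comp (g := fun t : R => -1 * (0 +i* t)) (cder_cexp _)
        (derZ (-1) (rder_vline 0 t)).
      rewrite (_ : -1 * (0 +i* t) = (0 +i* - t)) in d1; last first.
        by rewrite mulN1r; apply/eqP; rewrite eq_complex /= oppr0 !eqxx.
      apply: der_ext d1 => u; rewrite /cexp mulN1r /= oppr0 expR0.
      by rewrite mul1r.
    have dcis (t : R) : rder cis t (cexp (0 +i* t) * 'i%C).
      have := der_comp (g := fun u : R => 0 +i* u) (cder_cexp _) (rder_vline 0 t).
      by apply: der_ext => u; rewrite /cexp /= expR0 mul1r.
    have cc : rcontinuous (@cis R).
      by apply: rder_continuous => t; eexists; exact: dcis.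
    move=> t e e0; have L1 : 0 < L + 1 by rewrite ltr_wpDl.
    have [d d0 hd] := cc t (e / (L + 1)) (divr_gt0 e0 L1).
    exists d => // h /hd H.
    rewrite (_ : _ - _ = f' (w + 1 * cis t + (cis (t + h) - cis t)) - f' (w + 1 * cis t)).
      apply: le_trans (HL _ _ _ _) _; first by have := wc t; lra.
        by apply: le_trans (nmB _ _) _; rewrite !nm_cis; lra.
      rewrite ler_pdivlMr// in H; apply: le_trans H.
      by rewrite mulrDr mulr1 mulrC lerDl nm_ge0.
    rewrite !mul1r (_ : w + cis t + _ = w + cis (t + h)); first by ring.
    by ring.
  apply/funext => t; congr (_ * _); rewrite mul1r.
  by apply/eqP; rewrite eq_complex /= cos2Dsin2 !divr1 cosN sinN !eqxx.
have [Y3 hY3] := rder_primitive rc.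
pose c := Y3 (2 * pi) - Y3 0.
have pi0 : 0 < 2 * pi :> R by rewrite mulr_gt0 ?pi_gt0.
have pin : (2 * pi)%:C != 0 :> R[i] by rewrite -nm_gt0 nmR gtr0_norm.
exists (c / (2 * pi)%:C) => e e0.
have B1 : 0 < 2 * B + 1 by rewrite ltr_wpDl ?mulr_ge0.
exists (Num.min 1 (e / (2 * B + 1))) => [|h].
  by rewrite lt_min ltr01 divr_gt0.
rewrite lt_min => /andP[h1]; rewrite ltr_pdivlMr// => he.
have [Yh hYh YhE] := derivative_formula hf (ff' (w + h)) (@ltr01 R).
have D t := derB (derB (hYh t) (hY t)) (derZ h (hY3 t)).
have := mean_value_le (ltW pi0) (fun t _ => D t) (K := 2 * B * nm h ^+ 2).
rewrite subr0 (_ : _ - _ - _ - _ = (Yh (2 * pi) - Yh 0) - (Y (2 * pi) - Y 0)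
  - h * (Y3 (2 * pi) - Y3 0)); last by ring.
rewrite YhE YE -/c (_ : _ - _ - _ = (2 * pi)%:C * (f' (w + h) - f' w - c / (2 * pi)%:C * h)); last first.
  by move: (2 * pi)%:C pin => P pin; field.
rewrite nmM nmR gtr0_norm// [leRHS]mulrC ler_pM2l// => /(_ _) /le_trans; apply.
  move=> t _.
  set z := w + 1 * cis t.
  (* The error of the integrand is the difference of the first-order Taylor remainders at the point
     of the circle and at its centre. *)
  rewrite (_ : _ - _ = ((f (z + h) - f z - f' z * h) - (f (w + h) - f w - f' w * h)) / (1 * cis t)).
    rewrite nmM Normc.normcV mul1r nm_cis invr1 mulr1.
    apply: le_trans (nmB _ _) _.
    rewrite [leRHS](_ : _ = B * nm h ^+ 2 + B * nm h ^+ 2); last by ring.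
    have hw : nm h <= nm w + 1 by lra.
    by apply: lerD; apply: HB => //; [exact: wc|rewrite lerDl].
  rewrite /z (_ : w + h + 1%:C * cis t = w + 1 * cis t + h); last by ring.
  by field; exact: cis_neq0.
rewrite expr2 mulrA ler_wpM2r ?nm_ge0//; apply: le_trans (ltW he).
by rewrite mulrDr mulr1 mulrC lerDl nm_ge0.
Qed.

End derivative.

(** Obtained by integrating the first-order expansion of [f'] at [w] along the segment to w + h.
    Order two is enough both to divide out a zero and to treat an even function at 0. *)
Lemma taylor2 f w : holo f -> exists l b, cder f w l /\
  forall e, 0 < e -> exists2 d, 0 < d & forall h, nm h < d ->
    nm (f (w + h) - f w - l * h - b * h ^+ 2) <= e * nm h ^+ 2.
Proof.
move=> hf; have /choice[f' ff'] := hf.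
have [m fm] := holo_deriv ff' w.
exists (f' w), (m / 2); split=> // e e0; have [d d0 hd] := fm e e0.
exists d => // h hh.
have D (t : R) := derB (derB (rder_line (ff' (w + t%:C * h))) (derZ (f' w * h) (rder_real t)))
   (derZ (m / 2 * h ^+ 2) (der_comp (g := fun t : R => t%:C) (@cder_sqr _ _) (rder_real t))).
have := mean_value_le (@ler01 R) (fun t _ => D t) (K := e * nm h ^+ 2).
rewrite mul0r mul1r subr0 !mulr1 (_ : _ - _ - _ - _ = f (w + h) - f w - f' w * h - m / 2 * h ^+ 2).
  apply => t /andP[t0 t1].
  rewrite (_ : _ - _ - _ = (f' (w + t%:C * h) - f' w - m * (t%:C * h)) * h); last by field.
  rewrite nmM expr2 [leRHS]mulrA ler_wpM2r ?nm_ge0//.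
  have th : nm (t%:C * h) <= nm h.
    by rewrite nmM nmR ger0_norm// ler_piMl// nm_ge0.
  apply: le_trans (hd _ (le_lt_trans th hh)) _; by rewrite ler_wpM2l// ltW.
by rewrite addr0; ring.
Qed.

End regularity.

(** * Factorizations and the identity theorem *)

Section identity.
Context {R : realType}.
Implicit Types (f q : R[i] -> R[i]) (z w h : R[i]).

Lemma der_near f g z l d : 0 < d -> (forall h, nm h < d -> f (z + h) = g (z + h)) ->
  cder f z l -> cder g z l.
Proof.
move=> d0 fg fl e e0; have [d1 d10 h1] := fl e e0.
exists (Num.min d d1) => [|h]; first by rewrite lt_min d0.
rewrite lt_min => /andP[hd /h1]; rewrite fg//.
by have := fg 0; rewrite addr0 => ->//; rewrite Normc.normc0.
Qed.

Lemma nm_tri z w : nm z - nm w <= nm (z + w).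
Proof. by rewrite lerBlDr -[z in leLHS](addrK w); exact: nmB. Qed.

Lemma cder_inv z : z != 0 -> cder (fun t => t^-1) z (- z ^- 2).
Proof.
move=> z0 e e0; have nz : 0 < nm z by rewrite nm_gt0.
have n2 : 0 < nm z / 2 by rewrite divr_gt0.
exists (Num.min (nm z / 2) (e * (nm z ^+ 3 / 2))) => [|h].
  by rewrite lt_min n2/= mulr_gt0// divr_gt0// exprn_gt0.
rewrite lt_min => /andP[h1 h2].
have zh : nm z / 2 <= nm (z + h) by have := nm_tri z h; lra.
have zh0 : z + h != 0 by rewrite -nm_gt0; exact: lt_le_trans zh.
rewrite (_ : _ - _ = h * (h / (z ^+ 2 * (z + h)))); last by field; rewrite zh0.
rewrite nmM mulrC ler_wpM2r ?nm_ge0// nmM Normc.normcV nmM nmX.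
rewrite ler_pdivrMr; last by rewrite mulr_gt0 ?exprn_gt0// (lt_le_trans _ zh).
apply: le_trans (ltW h2) _; rewrite ler_pM2l//.
by rewrite exprSr -mulrA ler_pM2l// exprn_gt0.
Qed.

(** With h(w) = f(sqrt w), evenness makes the branch of the root irrelevant. At 0 the linear term of
    [f] vanishes by evenness, and the quadratic coefficient is the derivative of [h]. Elsewhere the
    derivative is f'(z0) / (2 z0) with z0^2 = w0. *)
Lemma even_factor f : holo f -> (forall z, f (- z) = f z) ->
  exists2 h, holo h & forall z, h (z ^+ 2) = f z.
Proof.
move=> hf fN; pose h w := f (sqrtc w).
have hE z : h (z ^+ 2) = f z.
  have /eqP := sqr_sqrtc (z ^+ 2).
  by rewrite eqf_sqr /h => /orP[] /eqP ->.
have hE' z w : z ^+ 2 = w -> h w = f z by move=> <-.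
exists h => // w0; have [->|w00] := eqVneq w0 0.
  have [l [b [fl fb]]] := taylor2 0 hf.
  have l0 : l = 0.
    have : cder f 0 (l * - 1).
      have fl' : cder f (- 0) l by rewrite oppr0.
      have := der_comp (g := fun t => - t) fl' (derN (cder_id 0)).
      by apply: der_ext => t; exact: fN.
    move=> /(cder_uniq fl)/eqP; rewrite mulrN1 -addr_eq0 -mulr2n mulrn_eq0/=.
    by move=> /eqP.
  exists b => e e0; have [d d0 hd] := fb e e0.
  exists (d ^+ 2) => [|k kd]; first by rewrite exprn_gt0.
  have := hd (sqrtc k); rewrite l0 !add0r mul0r subr0 sqr_sqrtc -nmX sqr_sqrtc.
  rewrite (hE' (sqrtc k) k) ?sqr_sqrtc// (hE' 0 0) ?expr0n//; apply.
  by rewrite -(ltr_pXn2r (n := 2)) ?nnegrE ?nm_ge0 ?ltW// -nmX sqr_sqrtc.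
pose z0 := sqrtc w0; have z02 : z0 ^+ 2 = w0 by exact: sqr_sqrtc.
have z00 : z0 != 0 by rewrite sqrtc_eq0.
have nz : 0 < nm z0 by rewrite nm_gt0.
have [m fm] := hf z0; have m1 : 0 < nm m + 1 by rewrite ltr_wpDl ?nm_ge0.
exists (m / (2 * z0)) => e e0.
have [d d0 hd] := fm (e * nm z0 / 2) ltac:(by rewrite divr_gt0 ?mulr_gt0).
(* The first bound puts the root [z] of w0 + k within [d] of z0; the second controls the error of
   replacing z + z0 by 2 z0. Each error takes half of [e]. *)
exists (Num.min (d * nm z0) (e * nm z0 ^+ 3 / (nm m + 1))) => [|k].
  by rewrite lt_min mulr_gt0 //= divr_gt0 // mulr_gt0 // exprn_gt0.
rewrite lt_min => /andP[k1 k2].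
(* Of the two roots, the one on the side of z0 is chosen: |s + z0| and |-s + z0| cannot both be
   below |z0|, since the sum of the two numbers is 2 z0. Then z - z0 = k / (z + z0) is small. *)
have [z zk zz] : exists2 z, z ^+ 2 = w0 + k & nm z0 <= nm (z + z0).
  pose s := sqrtc (w0 + k); have s2 : s ^+ 2 = w0 + k by exact: sqr_sqrtc.
  have [a|a] := leP (nm z0) (nm (s + z0)); first by exists s.
  exists (- s); first by rewrite sqrrN.
  have := nmD (- s + z0) (s + z0).
  rewrite (_ : _ + (s + z0) = 2%:C * z0); last by ring.
  by rewrite nmM nmR ger0_norm//; lra.
have zz0 : z + z0 != 0 by rewrite -nm_gt0; exact: lt_le_trans zz.
have dz : z - z0 = k / (z + z0).
  by apply: (mulIf zz0); rewrite divfK// -subr_sqr zk z02 addrC addKr.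
have ndz : nm (z - z0) <= nm k / nm z0.
  rewrite dz nmM Normc.normcV ler_wpM2l ?nm_ge0// lef_pV2// posrE//.
  exact: lt_le_trans zz.
rewrite (hE' z)// (hE' z0)//.
rewrite (_ : _ - _ = (f (z0 + (z - z0)) - f z0 - m * (z - z0)) - m * (k * (z - z0) / (2 * z0 * (z + z0)))).
  apply: le_trans (nmB _ _) _.
  have t1 : nm (f (z0 + (z - z0)) - f z0 - m * (z - z0)) <= e / 2 * nm k.
    have /hd H : nm (z - z0) < d by apply: le_lt_trans ndz _; rewrite ltr_pdivrMr.
    apply: le_trans H _; rewrite [leRHS](_ : _ = e * nm z0 / 2 * (nm k / nm z0)).
      by rewrite ler_wpM2l// !(mulr_ge0, divr_ge0)// ltW.
    by field; rewrite gt_eqF.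
  have t2 : nm (m * (k * (z - z0) / (2 * z0 * (z + z0)))) <= e / 2 * nm k.
    rewrite !nmM Normc.normcV !nmM (_ : nm 2 = 2); last first.
      by rewrite (_ : 2 = 2%:C) ?nmR ?ger0_norm// rmorph_nat.
    apply: le_trans (_ : (nm m + 1) * (nm k * (nm k / nm z0) / (2 * nm z0 * nm z0)) <= _).
      apply: ler_pM; rewrite ?lerDl//.
      - exact: nm_ge0.
      - by rewrite !(mulr_ge0, divr_ge0, nm_ge0, invr_ge0).
      apply: ler_pM.
      - by rewrite !(mulr_ge0, nm_ge0).
      - by rewrite !(mulr_ge0, nm_ge0, invr_ge0).
      - by rewrite ler_wpM2l ?nm_ge0.
      rewrite lef_pV2 ?posrE ?mulr_gt0//; last exact: lt_le_trans zz.
      by rewrite ler_pM2l// mulr_gt0.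
    rewrite ltr_pdivlMr// in k2.
    rewrite [leLHS](_ : _ = nm k * (nm m + 1) * (nm k / (2 * nm z0 ^+ 3))); last first.
      by field; rewrite gt_eqF.
    rewrite [leRHS](_ : _ = (e * nm z0 ^+ 3) * (nm k / (2 * nm z0 ^+ 3))); last first.
      by field; rewrite gt_eqF.
    by rewrite ler_wpM2r ?(ltW k2)// divr_ge0 ?nm_ge0// mulr_ge0// exprn_ge0// ltW.
  lra.
rewrite (_ : z0 + (z - z0) = z); last by ring.
have kE : k = (z - z0) * (z + z0) by rewrite dz divfK.
by rewrite kE; field; rewrite zz0 z00.
Qed.

(** Filling the hole of f(z) / (z - w) with f'(w), the second-order coefficient of [f] at [w]
    becomes the derivative of the quotient there. *)
Lemma holo_div f w : holo f -> f w = 0 ->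
  exists2 q, holo q & forall z, f z = (z - w) * q z.
Proof.
move=> hf fw; have [l [b [fl fb]]] := taylor2 w hf.
pose q z := if z == w then l else f z / (z - w).
exists q => [z|z]; last first.
  rewrite /q; have [->|zw] := eqVneq z w; first by rewrite subrr mul0r.
  by rewrite mulrC divfK// subr_eq0.
have [->|zw] := eqVneq z w.
  exists b => e e0; have [d d0 hd] := fb e e0; exists d => // h hh.
  rewrite /q eqxx; have [h0|h0] := eqVneq h 0.
    rewrite h0 addr0 eqxx subrr mulr0 subr0 Normc.normc0.
    by rewrite mulr0.
  rewrite ifF; last by rewrite -subr_eq0 addrC addKr; exact/negbTE.
  rewrite (_ : w + h - w = h); last by ring.
  have := hd h hh; rewrite fw subr0.
  rewrite (_ : f _ - _ - _ = (f (w + h) / h - l - b * h) * h); last by field.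
  by rewrite nmM expr2 mulrA ler_pM2r// nm_gt0.
have [m fm] := hf z; have zw0 : z - w != 0 by rewrite subr_eq0.
eexists.
apply: (@der_near (fun z => f z * (z - w)^-1) _ _ _ (nm (z - w))).
- by rewrite nm_gt0.
- move=> h hh; rewrite /q ifF//; apply/negP => /eqP E.
  by move: hh; rewrite -E opprD addNKr nmN ltxx.
- apply: (derM fm (der_comp (g := fun t => t - w) (cder_inv zw0) _)).
  exact: derB (cder_id z) (der_cst id w z).
Qed.

Definition nonisolated_zero f w := forall d, 0 < d ->
  exists z, [/\ z != w, nm (z - w) < d & f z = 0].

Lemma nonisolated_zero_root f w : holo f -> nonisolated_zero f w -> f w = 0.
Proof.
move=> hf aw; apply: nm_le_eps => e e0; have [l fl] := hf w.
have [d d0 hd] := der_cont fl e0; have [z [_ zd fz]] := aw d d0.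
by have := hd _ zd; rewrite (_ : w + (z - w) = z) ?fz ?sub0r ?nmN//; ring.
Qed.

Lemma nonisolated_zero_div f w n : holo f -> nonisolated_zero f w ->
  exists2 q, holo q & forall z, f z = (z - w) ^+ n * q z.
Proof.
move=> hf aw.
suff [q [hq _ qE]] : exists q, [/\ holo q, nonisolated_zero q w &
  forall z, f z = (z - w) ^+ n * q z] by exists q.
elim: n => [|n [q [hq aq qE]]].
  by exists f; split=> // z; rewrite expr0 mul1r.
have [p hp pE] := holo_div hq (nonisolated_zero_root hq aq).
exists p; split=> // [d d0|z]; last by rewrite qE pE exprSr mulrA.
have [z [zw zd qz]] := aq d d0; exists z; split=> //.
by move/eqP: qz; rewrite pE mulf_eq0 subr_eq0 (negbTE zw) /= => /eqP.
Qed.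

(** Every power of z - w can be divided out. On the circle of radius 3 rho around [z] the distance
    to [w] is at least 2 rho, whereas |z - w| < rho; estimating the quotient at [z] from that circle
    thus gains 2^n, and n is arbitrary. This reaches every [z] at once, without power series or
    connectedness. *)
Lemma identity_theorem f w : holo f -> nonisolated_zero f w -> forall z, f z = 0.
Proof.
move=> hf aw z; pose rho := nm (z - w) + 1.
have r0 : 0 < rho by rewrite ltr_wpDl ?nm_ge0.
have [M M0 HM] := holo_bounded (nm z + 3 * rho) hf.
have bd n : nm (f z) <= M / 2 ^+ n.
  have [q hq qE] := nonisolated_zero_div n hf aw.
  have [m qm] := hq z.
  (* The Cauchy estimate bounds derivatives only; the value [q z] is made into the derivative at [z]
     of (u - z) q(u). *)
  have km : cder (fun u => (u - z) * q u) z (q z).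
    have := derM (derB (cder_id z) (der_cst id z z)) qm.
    by apply: der_eq; rewrite subrr mul0r addr0 subr0 mul1r.
  have hk : holo (fun u => (u - z) * q u).
    move=> u; have [p qp] := hq u.
    by eexists; exact: (derM (derB (cder_id u) (der_cst id z u)) qp).
  have r3 : 0 < 3 * rho by rewrite mulr_gt0.
  have := @cauchy_estimate _ _ _ _ hk km (3 * rho) (3 * rho * (M / (2 * rho) ^+ n)) r3.
  rewrite [_ / (3 * rho)]mulrAC divff ?gt_eqF// mul1r => H.
  rewrite qE nmM nmX; apply: le_trans (_ : rho ^+ n * (M / (2 * rho) ^+ n) <= _).
    apply: ler_pM; rewrite ?exprn_ge0 ?nm_ge0//.
      by rewrite lerXn2r ?nnegrE ?nm_ge0 ?(ltW r0)// lerDl.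
    apply: H => t; rewrite subrr mul0r subr0 (_ : _ - z = (3 * rho)%:C * cis t); last by ring.
    rewrite nmM nmM nmR nm_cis mulr1 gtr0_norm// ler_pM2l//.
    set u := z + _; have := qE u; move=> /(congr1 (@Normc.normc R)); rewrite nmM nmX.
    have uw : 2 * rho <= nm (u - w).
      have := nm_tri ((3 * rho)%:C * cis t) (z - w).
      rewrite nmM nmR nm_cis mulr1 gtr0_norm// (_ : _ + (z - w) = u - w); last first.
        by rewrite /u; ring.
      by rewrite /rho; lra.
    have uw0 : 0 < nm (u - w) by apply: lt_le_trans uw; rewrite mulr_gt0.
    move=> E; rewrite ler_pdivlMr ?exprn_gt0 ?mulr_gt0//.
    apply: le_trans (_ : nm (f u) <= _); last first.
      apply: HM; apply: le_trans (nmD _ _) _.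
      by rewrite nmM nmR nm_cis mulr1 gtr0_norm.
    rewrite E mulrC ler_wpM2r ?nm_ge0// lerXn2r ?nnegrE ?nm_ge0//.
    by rewrite mulr_ge0// ltW.
  by rewrite exprMn invfM mulrCA [_ ^+ n * _]mulrA mulrAC divff ?mul1r// expf_neq0 ?gt_eqF//.
apply: nm_le_eps => e e0.
pose n := (Num.truncn (M / e)).+1.
apply: le_trans (bd n) _; rewrite ler_pdivrMr ?exprn_gt0// mulrC -ler_pdivrMr//.
apply: le_trans (ltW (truncnS_gt _)) _.
by rewrite -natrX ler_nat ltnW// ltn_expl.
Qed.

End identity.

(** * Entire functions on C^d *)

Lemma differentiable_line (K : numFieldType) (V : normedModType K) (F : V -> K^o) (x v : V) :
  differentiable F x -> exists l, forall e : K, 0 < e -> exists2 d, 0 < d &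
    forall h : K, `|h| < d -> `|F (x + h *: v) - F x - l * h| <= e * `|h|.
Proof.
move=> dF; pose g (t : K^o) : K^o := F (x + t *: v).
have : derivable g 0 1.
  apply/derivable1_diffP; apply: (@differentiable_comp _ _ V _ (fun t : K^o => x + t *: v) F).
    apply: differentiableD => //; apply: differentiableZl => //.
  by rewrite scale0r addr0.
move=> /derivableP /is_derive_normP H; eexists => e /H [d d0 hd].
exists d => // h /hd; rewrite /g add0r scale0r addr0; exact.
Qed.

Section entire.
Context {R : realType}.

Lemma entire_line d (F : 'rV[R[i]]_d -> R[i]) a v : entire F ->
  holo (fun t => F (a + t *: v)).
Proof.
move=> eF z; have [l fl] := differentiable_line v (eF (a + z *: v)).
exists l => e e0; have [|d' /posC[r r0 ->] hd] := fl e%:C; first by rewrite ltcR.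
exists r => // h hr; have := hd h; rewrite !normC_nm ltcR -rmorphM lecR.
by rewrite scalerDl addrA; exact.
Qed.

Definition sumsq d (z : 'rV[R[i]]_d) : R[i] := \sum_(i < d) z 0 i ^+ 2.

Lemma entire_sumsq d (h : R[i] -> R[i]) : holo h -> entire (fun z : 'rV[R[i]]_d => h (sumsq z)).
Proof.
move=> hh z; apply: (@differentiable_comp _ _ R[i]^o R[i]^o (@sumsq d) h).
  rewrite (_ : @sumsq d = \sum_(i < d) (fun z : 'rV[R[i]]_d => z 0 i : R[i]^o) ^+ 2).
    apply: differentiable_sum => i. 
    apply: differentiableX. exact: differentiable_coord.
  by apply/funext => u; rewrite fct_sumE.
apply/derivable1_diffP; have [l /cderP hl] := hh (sumsq z).
by case: hl.
Qed.
End entire.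

(** * Real zeros form a null set *)

Section zero_set.
Context {R : realType}.

Lemma holo_real_zeros_countable (f : R[i] -> R[i]) : holo f ->
  (exists z, f z != 0) -> countable [set x : R | f x%:C = 0].
Proof.
move=> hf [z fz]; set Z := mkset _.
suff ZE : isolated (Z : set R^o) = Z by rewrite -ZE; exact: countable_isolated.
apply/seteqP; split; first exact: isolatedS.
move=> x Zx; split; first exact/mem_set.
apply: contrapT => nV; move/eqP: fz; apply.
apply: (identity_theorem (w := x%:C) hf) => d d0.
apply: contrapT => nz; apply: nV; exists (ball x d); first exact: nbhsx_ballx.
apply/seteqP; split => [y [xy Zy]|y ->]; last by split => //; exact: ballxx.
apply: contrapT => yx; apply: nz; exists y%:C; split=> //.
  by apply/eqP => /complexI.
by rewrite -rmorphB nmR distrC.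
Qed.

Lemma cembed_tcons d (x : R) (t : d.-tuple R) :
  cembed (tcons (x, t)) = row_mx x%:C%:M (cembed t) :> 'rV_(1 + d).
Proof.
apply/rowP => i; rewrite !mxE; case: (@splitP 1 d) => j ij; rewrite !mxE.
  by rewrite (tnth_nth 0) ij !ord1 eqxx mulr1n.
by rewrite !(tnth_nth 0) ij.
Qed.

(** Induction on [d] with Fubini. If F is nonzero at (z_0, b), then F(x, b) vanishes for only
    countably many real x, and for every other x the slice F(x, .) is nonzero at [b]. Holomorphy is
    assumed along lines only, a property that slices inherit at once; [b] may be complex. *)
Lemma lebesgue_tuple_zero_set d (F : 'rV[R[i]]_d -> R[i]) :
  (forall a v, holo (fun t => F (a + t *: v))) -> (exists z, F z != 0) ->
  measurable [set x : d.-tuple R | F (cembed x) = 0] ->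
  lebesgue_tuple [set x : d.-tuple R | F (cembed x) = 0] = 0%E.
Proof.
elim: d F => [|d IH] F hF [z Fz] mZ.
  rewrite /= diracE memNset//= => F0; move/eqP: Fz; apply; rewrite -F0.
  by congr F; apply/rowP => -[].
have zE : z = row_mx (z 0 0)%:M (rsubmx (z : 'rV_(1 + d))).
  apply/rowP => i; rewrite !mxE; case: (@splitP 1 d) => j ij; rewrite !mxE.
    by rewrite ord1 eqxx mulr1n; congr (z _ _); apply/val_inj; rewrite /= ij ord1.
  by congr (z _ _); exact/val_inj.
pose b := rsubmx (z : 'rV_(1 + d)).
pose B := [set x : R | F (row_mx x%:C%:M b) = 0].
have cB : countable B.
  apply: (@holo_real_zeros_countable (fun t => F (row_mx t%:M b))); last first.
    by exists (z 0 0); rewrite -zE.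
  move=> t; have := hF (row_mx 0 b : 'rV_(1 + d)) (row_mx 1%:M 0 : 'rV_(1 + d)) t.
  congr (exists l, cder _ _ l); apply/funext => u; apply/funext => v.
  have E : row_mx 0 b + v *: row_mx 1%:M 0 = row_mx v%:M b :> 'rV_(1 + d).
    by rewrite scale_row_mx add_row_mx scaler0 addr0 add0r scale_scalar_mx mulr1.
  exact: (congr1 F E).
have mB : measurable (B : set (measurableTypeR R)).
  by apply: countable_measurable cB => t; exact: measurable_set1.
pose A := @tcons R d @^-1` [set x | F (cembed x) = 0].
have mA : measurable A.
  by rewrite -[A]setTI; exact: measurable_tcons.
rewrite /= /pushforward -/A /product_measure1.
rewrite (@ge0_negligible_integral _ (measurableTypeR R) R lebesgue_measure setT
  (B : set (measurableTypeR R)) (@lebesgue_tuple R d \o xsection A))//; last 2 first.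
- exact: measurable_fun_xsection.
- exact: countable_lebesgue_measure0.
apply: integral0_eq => x [_ Bx] /=.
have xsE : xsection A x = [set t | F (row_mx x%:C%:M (cembed t)) = 0].
  apply/seteqP; split => t; rewrite /xsection /A /= inE /=;
    rewrite (_ : cembed _ = row_mx x%:C%:M (cembed t))//;
    exact: cembed_tcons.
rewrite xsE.
apply: (IH (fun v => F (row_mx x%:C%:M v))).
- move=> a v t; have := hF (row_mx x%:C%:M a : 'rV_(1 + d)) (row_mx 0 v : 'rV_(1 + d)) t.
  congr (exists l, cder _ _ l); apply/funext => u; apply/funext => w.
  have E : row_mx x%:C%:M a + w *: row_mx 0 v = row_mx x%:C%:M (a + w *: v)
      :> 'rV_(1 + d).
    by rewrite scale_row_mx add_row_mx scaler0 addr0.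
  exact: (congr1 F E).
- by exists b; apply/eqP => /Bx.
- by rewrite -xsE; exact: measurable_xsection.
Qed.

End zero_set.

(** * The surface measure *)

Section euclidean.
Context {R : realType}.

Lemma tscaleA d (r s : R) (x : d.-tuple R) : tscale r (tscale s x) = tscale (r * s) x.
Proof. by apply: eq_from_tnth => i; rewrite !tnth_mktuple mulrA. Qed.

Lemma tscale1 d (x : d.-tuple R) : tscale 1 x = x.
Proof. by apply: eq_from_tnth => i; rewrite !tnth_mktuple mul1r. Qed.

Lemma tscale0 d (x : d.-tuple R) : tscale 0 x = tzero.
Proof. by apply: eq_from_tnth => i; rewrite !tnth_mktuple mul0r. Qed.

Lemma enorm_tscale d (r : R) (x : d.-tuple R) : enorm (tscale r x) = `|r| * enorm x.
Proof.
rewrite /enorm -sqrtr_sqr -sqrtrM ?sqr_ge0// mulr_sumr; congr Num.sqrt.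
by apply: eq_bigr => i _; rewrite tnth_mktuple exprMn.
Qed.

Lemma enorm_normalize d (x : d.-tuple R) : 0 < enorm x -> enorm (tscale (enorm x)^-1 x) = 1.
Proof.
move=> x0; rewrite enorm_tscale gtr0_norm ?invr_gt0// mulVf// gt_eqF//.
Qed.

Lemma measurable_tscaler d (r : R) : measurable_fun setT (@tscale R d r).
Proof. by apply: measurable_tscale => //; exact: measurable_id. Qed.

Lemma ge0_integral_oppr (m : {measure set (measurableTypeR R) -> \bar R})
    (D : set (measurableTypeR R)) (f : measurableTypeR R -> \bar R) :
  (forall A : set (measurableTypeR R), measurable A -> m (-%R @^-1` A) = m A) ->
  measurable D -> measurable_fun setT f -> (forall x, (0 <= f x)%E) ->
  (\int[m]_(x in D) f x = \int[m]_(x in -%R @^-1` D) f (- x)%R)%E.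
Proof.
move=> mN mD mf f0.
have mopp : measurable_fun setT (-%R : measurableTypeR R -> measurableTypeR R).
  exact: (@oppr_measurable R setT).
pose M : {measure set (measurableTypeR R) -> \bar R} :=
  measure_function_pushforward__canonical__measure_function_Measure m mopp.
rewrite (@eq_measure_integral _ (measurableTypeR R) R D M m f) => [|A mA _]; last exact/esym/mN.
by rewrite (ge0_integral_pushforward mopp)//; exact: measurable_funTS.
Qed.

Lemma lebesgue_tupleN d (A : set (d.-tuple R)) : measurable A ->
  lebesgue_tuple (tscale (-1) @^-1` A) = lebesgue_tuple A.
Proof.
elim: d A => [|d IH] A mA.
  rewrite (_ : tscale (-1) @^-1` A = A)//; apply/funext => x /=.
  by congr A; apply: eq_from_tnth => -[].
have mA' : measurable (@tcons R d @^-1` A).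
  by rewrite -[X in measurable X]setTI; exact: measurable_tcons.
rewrite /= /pushforward /product_measure1.
have E x : (@lebesgue_tuple R d \o xsection (@tcons R d @^-1` (tscale (-1) @^-1` A))) x
   = (@lebesgue_tuple R d \o xsection (@tcons R d @^-1` A)) (- x).
  rewrite /= -[RHS]IH; last exact: measurable_xsection.
  congr lebesgue_tuple; apply/seteqP; split => t; rewrite /xsection/= !inE/=;
    rewrite (_ : tscale (-1) (tcons (x, t)) = tcons (- x, tscale (-1) t))//;
    apply: eq_from_tnth => i; rewrite tnth_mktuple;
    case: (unliftP ord0 i) => [j ->|->];
    by rewrite ?tnthS ?tnth_mktuple// !(tnth_nth 0)/= mulN1r.
under eq_integral do rewrite E.
rewrite [RHS](ge0_integral_oppr (m := lebesgue_measure)) ?preimage_setT//.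
  by move=> B; exact: lebesgue_measureN.
exact: measurable_fun_xsection.
Qed.

Lemma surface_measureN d (A : set (d.-tuple R)) : measurable A ->
  surface_measure (tscale (-1) @^-1` A) = surface_measure A.
Proof.
move=> mA; rewrite /surface_measure; congr (_ * _)%E.
rewrite -[RHS]lebesgue_tupleN.
  congr lebesgue_tuple; apply/seteqP; split => x /=; rewrite enorm_tscale normrN1 mul1r.
    by rewrite !tscaleA mulN1r mulrN1.
  by rewrite !tscaleA mulN1r mulrN1.
apply: measurableI; first exact: measurable_unit_ball.
by rewrite -[X in measurable X]setTI; exact: measurable_normalize.
Qed.

Lemma surface_measure_off_sphere d :
  surface_measure [set x : d.-tuple R | enorm x != 1] = 0%E.
Proof.
rewrite /surface_measure (_ : mkset _ = set0) ?measure0 ?mule0//.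
apply/seteqP; split => // x /= [/andP[x0 _]].
by rewrite enorm_normalize// eqxx.
Qed.

(** The surface measure of [A] is a multiple of the volume of a cone over [A], and that cone lies in
    [B]. *)
Lemma surface_measure_cone0 d (A : set (d.-tuple R)) (B : set (d.-tuple R)) :
  measurable A -> measurable B ->
  (forall w r, A w -> 0 < r -> B (tscale r w)) -> lebesgue_tuple B = 0%E ->
  surface_measure A = 0%E.
Proof.
move=> mA mB AB B0; rewrite /surface_measure.
rewrite (@subset_measure0 _ _ _ (@lebesgue_tuple R d) _ B) ?mule0//.
  apply: measurableI; first exact: measurable_unit_ball.
  by rewrite -[X in measurable X]setTI; exact: measurable_normalize.
move=> x /= [/andP[x0 _] /AB /(_ x0)].
by rewrite tscaleA divff ?gt_eqF// tscale1.
Qed.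

Lemma lebesgue_tuple_box_gt0 d (c : R) : 0 < c ->
  measurable [set x : d.-tuple R | forall i, 0 < tnth x i <= c] /\
  (0 < lebesgue_tuple [set x : d.-tuple R | forall i, (0 < tnth x i <= c)%R])%E.
Proof.
move=> c0.
pose box n := [set x : n.-tuple R | forall i, 0 < tnth x i <= c].
have mbox n : measurable (box n).
  rewrite (_ : box n = \bigcap_(i in [set: 'I_n]) ((fun x => tnth x i) @^-1` `]0, c])).
    apply: (@fin_bigcap_measurable _ _ _ setT (fun i : 'I_n =>
      (fun x : n.-tuple R => tnth x i) @^-1` `]0, c])) => [|i _].
      exact: finite_finset.
    rewrite -[X in measurable X]setTI; apply: measurable_tnth => //.
  by apply/seteqP; split => [x bx i _|x bx i]; have := bx i; rewrite /= in_itv/=; exact.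
split; first exact: mbox.
elim: d => [|d IH].
  rewrite /= diracE mem_set//.
  by move=> -[].
rewrite /= /pushforward (_ : _ @^-1` _ = `]0, c] `*` box d); last first.
  apply/seteqP; split => [[a t] /= bt|[a t] /= [a1 bt] i].
    split; first by have := bt ord0; rewrite (tnth_nth 0) in_itv.
    by move=> i; have := bt (lift ord0 i); rewrite tnthS.
  case: (unliftP ord0 i) => [j ->|->]; last by rewrite (tnth_nth 0); rewrite in_itv in a1.
  by rewrite tnthS; exact: bt.
rewrite product_measure1E//; last exact: mbox.
apply: mule_gt0 => //; have : (0 < lebesgue_measure (`]0%R, c] : set R))%E.
  by rewrite lebesgue_measure_itv/= lte_fin c0 sube0 lte_fin.
exact.
Qed.

Lemma surface_measure_gt0 d : (0 < surface_measure [set: d.+1.-tuple R])%E.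
Proof.
rewrite /surface_measure mule_gt0 ?lte_fin//.
(* The cube (0, c]^(d+1) avoids the origin and lies in the unit ball: each square is at most [c]
   because c <= 1, and d + 1 of them sum to at most 1. *)
pose c : R := d.+1%:R^-1; have c0 : 0 < c by rewrite invr_gt0.
have [mb b0] := lebesgue_tuple_box_gt0 d.+1 c0.
apply: lt_le_trans b0 _; apply: le_measure; rewrite ?inE//.
  rewrite (_ : mkset _ = [set x | 0 < enorm x <= 1]); first exact: measurable_unit_ball.
  by apply/seteqP; split => x //= -[].
move=> x /= bx; split => //; apply/andP; split.
  rewrite sqrtr_gt0 big_ord_recl ltr_pwDl//.
    by rewrite exprn_gt0//; have /andP[] := bx ord0.
  by rewrite sumr_ge0// => i _; exact: sqr_ge0.
rewrite -(@sqrtr1 R) ler_wsqrtr//.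
apply: le_trans (_ : \sum_(i < d.+1) c <= _); last first.
  by rewrite sumr_const card_ord -mulr_natl divff.
apply: ler_sum => i _; have /andP[a b] := bx i.
have c1 : c <= 1 by rewrite invf_le1// ler1n.
apply: le_trans (b); rewrite expr2 ler_piMl ?(ltW a)//.
exact: le_trans b c1.
Qed.

End euclidean.

(** * Lifts and polar coordinates *)

Section locally_finite.
Context {R : realType}.

Lemma locally_finite_sigma_finite (mu : {measure set (measurableTypeR R) -> \bar R}) :
  locally_finite mu -> sigma_finite setT mu.
Proof.
move=> lf.
have mI (a b : R) : measurable (`[a, b] : set (measurableTypeR R)).
  exact: measurable_itv.
pose A (x y s : R) := (mu `[x, (x + s * 1)%R]%classic < +oo)%E.
have fin (n : nat) : (mu `[(- n%:R)%R, n%:R%R]%classic < +oo)%E.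
  (* The larger interval [-(n+1), n+1] has positive length even for n = 0, as bisection requires. *)
  suff : A (- n.+1%:R) 0 (2 * n.+1%:R).
    apply: le_lt_trans; apply: le_measure; rewrite ?inE//; try exact: mI.
    move=> x /=; rewrite !in_itv/= mulr1 -natr1; lra.
  apply: (@bisection_principle R A 1 0) => //.
    move=> x y s s0; rewrite /A !mulr1 => h1 h2 _ _.
    have E : (x + s = x + s / 2 + s / 2)%R by field.
    apply: le_lt_trans (lte_add_pinfty h1 h2).
    apply: le_trans (measureU2 _ _ _) => //; try exact: mI.
    apply: le_measure; rewrite ?inE//; try exact: mI.
      apply: measurableU; exact: mI.
    move=> z /=; rewrite !in_itv/= E => /andP[z1 z2].
    by case: (leP z (x + s / 2)) => hz; [left|right]; rewrite /= ?in_itv/= ?z1 ?hz ?z2 ?(ltW hz).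
  move=> p q _ _; have [U [oU Up Uoo]] := lf p.
  have /nbhs_ballP[d d0 hd] := open_nbhs_nbhs (conj oU Up).
  exists d => // x y s /andP[s0 sd]; rewrite /A mulr1 => xp _.
  apply: le_lt_trans Uoo; apply: le_measure; rewrite ?inE; first exact: mI.
    exact: open_measurable.
  move=> z /=; rewrite in_itv/= => zx; apply: hd.
  by rewrite /ball/= ltr_norml; lra.
exists (fun n : nat => `[- n%:R, n%:R]%classic) => //.
apply/seteqP; split => // x _ /=; exists (Num.truncn `|x|).+1 => //=.
by rewrite in_itv/= -ler_norml ltW// truncnS_gt.
Qed.

End locally_finite.

Section sigma_finite_copy.
Context {R : realType}.
Variable mu : {measure set (measurableTypeR R) -> \bar R}.

(* Local finiteness is only a hypothesis on mu, so the sigma-finite structure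
   that Fubini's theorem expects is attached to a copy of mu. *)
Definition sigma_finite_copy of sigma_finite setT mu := mu : set _ -> \bar R.

Variable sf : sigma_finite setT mu.
Local Notation nu := (sigma_finite_copy sf).

Let nu0 : nu set0 = 0%E. Proof. exact: (measure0 mu). Qed.
Let nu_ge0 A : (0 <= nu A)%E. Proof. exact: (measure_ge0 mu). Qed.
Let nu_sigma_additive : semi_sigma_additive nu.
Proof. exact: (@measure_semi_sigma_additive _ _ _ mu). Qed.

HB.instance Definition _ := isMeasure.Build _ _ _ nu nu0 nu_ge0 nu_sigma_additive.
HB.instance Definition _ := Measure_isSigmaFinite.Build _ _ _ nu sf.

Lemma sigma_finiteP :
  exists nu : {sigma_finite_measure set (measurableTypeR R) -> \bar R},
    mu = nu :> (set _ -> \bar R).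
Proof. by exists nu. Qed.

End sigma_finite_copy.

Section lift.
Context {R : realType} {d : nat}.
Variable mu : {sigma_finite_measure set (measurableTypeR R) -> \bar R}.
Hypothesis muN : even_measure mu.
Local Notation sigma := (@surface_measure R d).

Definition polar (p : measurableTypeR R * d.-tuple R) := tscale p.1 p.2.

Lemma measurable_polar : measurable_fun setT polar.
Proof.
have mid : measurable_fun [set: measurableTypeR R] (idfun : _ -> R).
  by move=> _ A mA; rewrite setTI.
apply: measurable_tscale; last exact: measurable_snd.
exact: (measurableT_comp mid (@measurable_fst _ _ _ (d.-tuple R))).
Qed.

Lemma even_measure_preimage (A : set (measurableTypeR R)) : measurable A ->
  mu (-%R @^-1` A) = mu A.
Proof.
move=> mA; rewrite -[RHS](muN mA); congr (mu _); apply/seteqP; split => x /=.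
  by exists (- x)%R => //; rewrite opprK.
by move=> [y Ay <-]; rewrite opprK.
Qed.

(** Negative radii contribute as much as positive ones, because mu is even and the surface measure
    is invariant under the antipodal map; the radius 0 contributes the atom, whose factor 1/2 is
    doubled on the left. Adding the lift to itself avoids a division in the extended reals. *)
Lemma lift_polar A : measurable A ->
  (Defs.lift mu A + Defs.lift mu A = (mu \x sigma) (polar @^-1` A))%E.
Proof.
move=> mA; have mpA : measurable (polar @^-1` A).
  by rewrite -[X in measurable X]setTI; exact: measurable_polar.
pose psi (r : measurableTypeR R) := sigma (tscale r @^-1` A).
have psi0 r : (0 <= psi r)%E by exact: measure_ge0.
have mpsi : measurable_fun setT psi.
  rewrite (_ : psi = sigma \o xsection (polar @^-1` A)).
    exact: measurable_fun_xsection.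
  apply/funext => r; congr (sigma _); apply/seteqP.
  by split => x; rewrite /xsection/= inE.
have psiN r : psi (- r) = psi r.
  rewrite /psi -[RHS]surface_measureN.
    congr (sigma _); apply/seteqP; split => x /=.
      by rewrite tscaleA mulrN1.
    by rewrite tscaleA mulrN1.
  by rewrite -[X in measurable X]setTI; exact: measurable_tscaler.
have RHSE : ((mu \x sigma) (polar @^-1` A) = \int[mu]_r psi r)%E.
  apply: eq_integral => r _; congr (sigma _); apply/seteqP.
  by split => x; rewrite /xsection/= inE.
have m1 : measurable (`]-oo, 0%R[ : set (measurableTypeR R)) by exact: measurable_itv.
have m2 : measurable (`]0%R, +oo[ : set (measurableTypeR R)) by exact: measurable_itv.
have m3 : measurable ([set 0%R] : set (measurableTypeR R)) by exact: measurable_set1.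
have TE : [set: measurableTypeR R] = `]0%R, +oo[%classic `|` (`]-oo, 0%R[%classic `|` [set 0%R]).
  apply/seteqP; split => // x _ /=; rewrite !in_itv/= andbT.
  by case: (ltgtP x 0%R) => hx; [right; left|left|right; right].
have neg : (\int[mu]_(r in `]-oo, 0%R[) psi r = \int[mu]_(r in `]0%R, +oo[) psi r)%E.
  rewrite (ge0_integral_oppr even_measure_preimage)//.
  rewrite (_ : _ @^-1` _ = `]0%R, +oo[%classic).
    by apply: eq_integral => r _; exact: psiN.
  by apply/seteqP; split => x /=; rewrite !in_itv/= andbT oppr_lt0.
have zer : (\int[mu]_(r in [set 0%R]) psi r = sigma setT * mu [set 0%R] * \d_(@tzero R d) A)%E.
  rewrite (eq_integral (cst (psi 0%R))); last by move=> r; rewrite inE => ->.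
  rewrite integral_cst//.
  suff -> : psi 0%R = (sigma setT * \d_(@tzero R d) A)%E by rewrite muleAC.
  rewrite /psi diracE; case: (boolP (tzero \in A)) => tA.
    rewrite mule1 (_ : _ @^-1` _ = setT)//; apply/seteqP; split => // x _ /=.
    by rewrite tscale0; exact: set_mem.
  rewrite mule0 (_ : _ @^-1` _ = set0) ?measure0//; apply/seteqP; split => // x /=.
  by rewrite tscale0 => /mem_set; rewrite (negbTE tA).
rewrite RHSE TE ge0_integral_setU//; last 3 first.
- exact: measurableU.
- exact: measurable_funTS.
- apply/disj_setPS => x [/=]; rewrite !in_itv/= andbT => x0 [|x1].
    by move=> /(lt_trans x0); rewrite ltxx.
  by move: x0; rewrite x1 ltxx.
rewrite ge0_integral_setU//; last 2 first.
- exact: measurable_funTS.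
- by apply/disj_setPS => x [/=]; rewrite !in_itv/= => x0 x1; move: x0; rewrite x1 ltxx.
rewrite neg zer /Defs.lift -/psi addeA addeACA; congr (_ + _)%E.
rewrite -!muleA -ge0_muleDl// -EFinD.
have h2 : (2^-1 + 2^-1)%R = 1%R :> R by field.
by rewrite h2 mul1e.
Qed.

Lemma ge0_integral_lift (f : d.-tuple R -> \bar R) :
  measurable_fun setT f -> (forall x, 0 <= f x)%E ->
  (\int[Defs.lift mu]_x f x + \int[Defs.lift mu]_x f x =
   \int[mu \x sigma]_p f (polar p))%E.
Proof.
move=> mf f0.
pose M : {measure set (d.-tuple R) -> \bar R} :=
  measure_function_pushforward__canonical__measure_function_Measure
    (mu \x sigma)%E measurable_polar.
rewrite -ge0_integral_measure_add//.
rewrite (@eq_measure_integral _ _ _ setT M) => [|A mA _].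
  by rewrite (ge0_integral_pushforward measurable_polar).
exact: (etrans (measure_addE _ _ _) (lift_polar mA)).
Qed.

(** The alternative with [- r] serves dimension 1, where [k] need not be even and the sphere
    consists of the directions 1 and -1; evenness of mu gives both directions the same integral. *)
Lemma ge0_integral_lift_radial (f : d.-tuple R -> \bar R) (k : measurableTypeR R -> \bar R) :
  measurable_fun setT f -> (forall x, 0 <= f x)%E ->
  measurable_fun setT k -> (forall x, 0 <= k x)%E ->
  (forall w, enorm w = 1 -> (forall r, f (tscale r w) = k r) \/
     (forall r, f (tscale r w) = k (- r)%R)) ->
  (\int[Defs.lift mu]_x f x + \int[Defs.lift mu]_x f x =
   sigma setT * \int[mu]_r k r)%E.
Proof.
move=> mf f0 mk k0 fk; rewrite ge0_integral_lift//.
have mfp : measurable_fun setT (fun p => f (polar p)).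
  exact: (measurableT_comp mf measurable_polar).
rewrite (fubini_tonelli2 (m1 := mu) (m2 := sigma) _ mfp)//.
rewrite muleC -integral_cst//.
apply: ge0_ae_eq_integral => //.
- exact: measurable_fun_fubini_tonelli_G.
- by move=> x _; exact: integral_ge0.
- by move=> x _; exact: integral_ge0.
exists [set w | enorm w != 1]; split.
- rewrite (_ : mkset _ = enorm @^-1` (~` [set 1])).
    rewrite -[X in measurable X]setTI; apply: measurable_enorm => //.
    exact: measurableC.
  by apply/seteqP; split => x /eqP.
- exact: surface_measure_off_sphere.
move=> w /=; apply: contra_not_neq => w1 _; rewrite /fubini_G/=.
have [E|E] := fk w w1; first by apply: eq_integral => r _; exact: E.
rewrite [RHS](ge0_integral_oppr even_measure_preimage)// preimage_setT.
by apply: eq_integral => r _; exact: E.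
Qed.

Lemma ge0_integral_liftE (f : d.-tuple R -> \bar R) (k : measurableTypeR R -> \bar R) :
  measurable_fun setT f -> (forall x, 0 <= f x)%E ->
  measurable_fun setT k -> (forall x, 0 <= k x)%E ->
  (forall w, enorm w = 1 -> (forall r, f (tscale r w) = k r) \/
     (forall r, f (tscale r w) = k (- r)%R)) ->
  (\int[Defs.lift mu]_x f x = (fine (sigma setT) / 2)%:E * \int[mu]_r k r)%E.
Proof.
move=> mf f0 mk k0 fk; have := ge0_integral_lift_radial mf f0 mk k0 fk.
have I0 : (0 <= \int[Defs.lift mu]_x f x)%E by exact: integral_ge0.
move=> /(congr1 (fun x => (2^-1)%:E * x)%E).
rewrite ge0_muleDr// -ge0_muleDl// -EFinD (_ : (2^-1 + 2^-1)%R = 1%R :> R); last by field.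
by rewrite mul1e => ->; rewrite muleA mulrC EFinM fineK// fin_num_measure.
Qed.

(** The proportionality of integrals, with a finite positive constant, is applied to the absolute
    value and to the positive and negative parts; integrability and the sign of the integral then
    pass in both directions. *)
Lemma integrable_lift_radial (f : d.-tuple R -> R) (k : measurableTypeR R -> R) :
  (0 < sigma setT)%E -> measurable_fun setT f -> measurable_fun setT k ->
  (forall w, enorm w = 1 -> (forall r, f (tscale r w) = k r) \/
     (forall r, f (tscale r w) = k (- r)%R)) ->
  ((Defs.lift mu).-integrable setT (EFin \o f) <-> mu.-integrable setT (EFin \o k)) /\
  (mu.-integrable setT (EFin \o k) ->
    (\int[Defs.lift mu]_x (f x)%:E <= 0 <-> \int[mu]_r (k r)%:E <= 0)%E).
Proof.
move=> s0 mf mk fk.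
have mEf : measurable_fun setT (EFin \o f) by exact/measurable_EFinP.
have mEk : measurable_fun setT (EFin \o k) by exact/measurable_EFinP.
have c0 : 0 < fine (sigma setT) / 2.
  by rewrite divr_gt0// fine_gt0// s0/= -ge0_fin_numE// fin_num_measure.
pose c := fine (sigma setT) / 2.
have E (t : \bar R -> \bar R) : measurable_fun setT t -> (forall x, 0 <= t x)%E ->
    (\int[Defs.lift mu]_x t (f x)%:E = c%:E * \int[mu]_r t (k r)%:E)%E.
  move=> mt t0; apply: ge0_integral_liftE => //.
  - exact: (measurableT_comp mt mEf).
  - exact: (measurableT_comp mt mEk).
  - by move=> w /fk[h|h]; [left|right] => r; rewrite h.
have Eabs := E _ (@abse_measurable R setT) (fun=> abse_ge0 _).
have mp : measurable_fun setT (fun x : \bar R => maxe x 0%E).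
  by apply: measurable_maxe; [exact: measurable_id|exact: measurable_cst].
have mn : measurable_fun setT (fun x : \bar R => maxe (- x)%E 0%E).
  by apply: measurable_maxe; [exact: oppe_measurable|exact: measurable_cst].
have Epos : (\int[Defs.lift mu]_x (EFin \o f)^\+ x = c%:E * \int[mu]_r (EFin \o k)^\+ r)%E.
  under eq_integral do rewrite funeposE.
  under [X in _ = (_ * X)%E]eq_integral do rewrite funeposE.
  by apply: (E _ mp) => x; rewrite le_max lexx orbT.
have Eneg : (\int[Defs.lift mu]_x (EFin \o f)^\- x = c%:E * \int[mu]_r (EFin \o k)^\- r)%E.
  under eq_integral do rewrite funenegE.
  under [X in _ = (_ * X)%E]eq_integral do rewrite funenegE.
  by apply: (E _ mn) => x; rewrite le_max lexx orbT.
split.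
  split => /integrableP[_ fi]; apply/integrableP; split => //.
    move: fi; rewrite Eabs; set y := (\int[mu]_r _)%E.
    rewrite !ltey; apply: contra => /eqP ->; by rewrite gt0_muley.
  by rewrite Eabs lte_mul_pinfty// lee_fin ltW.
move=> ik; rewrite integralE Epos Eneg [in X in _ <-> X]integralE.
have fp := integrable_pos_fin_num measurableT ik.
have fn := integrable_neg_fin_num measurableT ik.
rewrite -muleBr//; last by rewrite fin_num_adde_defl// fin_numN.
by rewrite pmule_rle0.
Qed.

End lift.

(** * Restriction to a line through the origin *)

Section restriction_to_lines.
Context {R : realType}.

Lemma ae_gt0_integral_le0 d (T : measurableType d) (m : {measure set T -> \bar R})
    (G : T -> \bar R) : measurable_fun setT G ->
  {ae m, forall x, (0 < G x)%E} -> (\int[m]_x G x <= 0)%E -> m setT = 0%E.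
Proof.
move=> mG G0 IG.
have : (\int[m]_x `|G x| = 0)%E.
  apply/eqP; rewrite eq_le integral_ge0// andbT; apply: le_trans IG.
  rewrite (_ : integral _ _ _ = \int[m]_x G x)%E//.
  apply: ae_eq_integral => //; first exact: measurableT_comp.
  by apply: filterS G0 => x Gx _; rewrite gee0_abs// ltW.
move=> /(ae_eq_integral_abs m measurableT mG) G00.
have [N [mN N0 TN]] : {ae m, forall x : T, False}.
  by apply: filterS2 G0 G00 => x /= Gx /(_ I) G0; move: Gx; rewrite G0 ltxx.
apply/eqP; rewrite eq_le measure_ge0 andbT -N0; apply: le_measure; rewrite ?inE//.
by move=> x _; apply: TN.
Qed.

Lemma cembed_tscale d (r : R) (w : d.-tuple R) :
  cembed (tscale r w) = r%:C *: cembed w.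
Proof. by apply/rowP => i; rewrite !mxE tnth_mktuple rmorphM. Qed.

Lemma sum_mul_le1 d (w t : d.-tuple R) : enorm w <= 1 -> enorm t <= 1 ->
  `|\sum_(i < d) tnth w i * tnth t i| <= 1.
Proof.
have sq (u : d.-tuple R) : enorm u <= 1 -> \sum_(i < d) tnth u i ^+ 2 <= 1.
  move=> u1; rewrite -[leLHS]sqr_sqrtr; first by rewrite expr_le1// sqrtr_ge0.
  by rewrite sumr_ge0// => i _; exact: sqr_ge0.
move=> /sq w1 /sq t1; apply: le_trans (ler_norm_sum _ _ _) _.
apply: le_trans (_ : \sum_(i < d) (tnth w i ^+ 2 + tnth t i ^+ 2) / 2 <= _).
  apply: ler_sum => i _; rewrite ler_pdivlMr// -subr_ge0.
  rewrite -[tnth w i ^+ 2]real_normK ?num_real// -[tnth t i ^+ 2]real_normK ?num_real//.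
  rewrite normrM (_ : _ - _ = (`|tnth w i| - `|tnth t i|) ^+ 2) ?sqr_ge0//.
  by ring.
by rewrite -mulr_suml big_split/= ler_pdivrMr//; lra.
Qed.

(** Cauchy-Schwarz bounds the supremum and t = w attains it. Hence slicing along a real unit vector
    does not raise the exponential type. *)
Lemma dual_norm_line d (w : d.-tuple R) (c : R[i]) : enorm w = 1 ->
  dual_norm (c *: cembed w) = nm c.
Proof.
move=> w1; set E := [set nm (\sum_(i < d) (c *: cembed w) 0 i * (tnth t i)%:C)
  | t in [set t : d.-tuple R | enorm t <= 1]].
have EE t : nm (\sum_(i < d) (c *: cembed w) 0 i * (tnth t i)%:C) =
    nm c * `|\sum_(i < d) tnth w i * tnth t i|.
  rewrite -nmR -nmM rmorph_sum mulr_sumr; congr nm.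
  by apply: eq_bigr => i _; rewrite !mxE rmorphM mulrA.
have ub : ubound E (nm c).
  move=> _ [t t1 <-]; rewrite EE ler_piMr ?nm_ge0// sum_mul_le1// w1//.
have Ec : E (nm c).
  exists w; first by rewrite /= w1.
  rewrite EE (_ : \sum_(i < d) _ = 1) ?normr1 ?mulr1//.
  rewrite -[RHS](expr1n _ 2) -w1 sqr_sqrtr; last by rewrite sumr_ge0// => i _; exact: sqr_ge0.
  by apply: eq_bigr => i _; rewrite expr2.
apply/eqP; rewrite eq_le; apply/andP; split.
  by apply: ge_sup => //; exists (nm c).
by apply: ub_le_sup => //; exists (nm c).
Qed.

Lemma enorm1_unit (w : 1.-tuple R) : enorm w = `|tnth w ord0|.
Proof. by rewrite /enorm big_ord1 sqrtr_sqr. Qed.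

Lemma dual_norm1 (z : 'rV[R[i]]_1) : dual_norm z = nm (z 0 0).
Proof.
rewrite -[RHS](@dual_norm_line _ [tuple 1]); last by rewrite enorm1_unit normr1.
congr dual_norm; apply/rowP => i; rewrite !mxE ord1.
by rewrite (tnth_nth 0)/= mulr1.
Qed.

Lemma exp_type_slice d (F : 'rV[R[i]]_d -> R[i]) (w : d.-tuple R) : enorm w = 1 ->
  (exp_type (fun z : 'rV_1 => F (z 0 0 *: cembed w)%R) <= exp_type F)%E.
Proof.
move=> w1; rewrite /exp_type /limf_esup.
apply: le_ereal_inf_tmp => _ [V [M _ MV] <-].
pose V1 := [set z : 'rV[R[i]]_1 | M < dual_norm z].
apply: ereal_inf_le; exists (ereal_sup [set (((dual_norm z)^-1)%:E *
    lne (nm (F (z 0 0 *: cembed w)%R))%:E)%E | z in V1]).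
  by exists V1 => //; exists M.
apply: ge_ereal_sup => _ [z Vz <-]; apply: ereal_sup_ubound.
exists (z 0 0 *: cembed w).
  by apply: MV; move: Vz; rewrite /V1/= dual_norm1 dual_norm_line.
by rewrite dual_norm1 dual_norm_line.
Qed.

Lemma entire_slice d (F : 'rV[R[i]]_d -> R[i]) (v : 'rV[R[i]]_d) : entire F ->
  entire (fun z : 'rV_1 => F (z 0 0 *: v)).
Proof.
move=> eF z; apply: (@differentiable_comp _ 'rV[R[i]]_1 'rV[R[i]]_d R[i]^o (fun z => z 0 0 *: v) F).
  apply: differentiableZl; exact: differentiable_coord.
exact: eF.
Qed.

Lemma last_sign_change_le d1 d2 (f1 : d1.-tuple R -> R) (f2 : d2.-tuple R -> R) :
  eventually_nonneg f2 ->
  (forall r, (forall x, r <= enorm x -> 0 <= f2 x) ->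
     forall x, r <= enorm x -> 0 <= f1 x) ->
  last_sign_change f1 <= last_sign_change f2.
Proof.
(* Eventual non-negativity makes the set on the right non-empty, so its [inf] is not a default
   value; the maximum with 1 below makes the witness positive. *)
move=> [r0 h0] h12; apply: lb_le_inf.
  exists (Num.max r0 1); split; first by rewrite lt_max ltr01 orbT.
  by move=> x; rewrite ge_max => /andP[? _]; exact: h0.
move=> r [rpos hr]; apply: ge_inf; last by split => //; exact: h12.
by exists 0 => s [/ltW].
Qed.

Section slice.
Variables (mu : {sigma_finite_measure set (measurableTypeR R) -> \bar R}).
Hypothesis muN : even_measure mu.
Variables (delta : R) (d : nat) (F : 'rV[R[i]]_d.+1 -> R[i]).
Hypotheses (aF : admissible mu delta F) (F0 : exists z, F z != 0).

Let f := restr_reals F.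
Local Notation sigma := (@surface_measure R d.+1).

Let mf : measurable_fun setT f.
Proof. by have [_ _ /measurable_int /measurable_EFinP]:= aF. Qed.

Let fE x : F (cembed x) = (f x)%:C.
Proof.
by have [[_ rF] _ _ _ _] := aF; rewrite [LHS]complexE rF mulr0 addr0.
Qed.

Let null_set : exists2 N, measurable N /\ sigma N = 0%E &
  forall w, ~ N w -> exists z, F (z *: cembed w) != 0.
Proof.
have [[eF rF] _ _ _ _] := aF.
pose B := [set x : d.+1.-tuple R | F (cembed x) = 0].
have mB : measurable B.
  rewrite (_ : B = f @^-1` [set 0]).
    by rewrite -[X in measurable X]setTI; exact: mf.
  apply/seteqP; split => x; rewrite /B/= fE; last by move=> ->.
  by move=> /complexI.
have B0 : lebesgue_tuple B = 0%E.
  by apply: lebesgue_tuple_zero_set => // a v; exact: entire_line.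
(* Vanishing at the points w / (n + 1) is a countable, hence measurable, condition. Since these
   points accumulate at 0, it already forces F to vanish on the whole complex line through [w]. *)
pose N := \bigcap_n [set w : d.+1.-tuple R | B (tscale (n.+1%:R^-1) w)].
have mN : measurable N.
  apply: bigcapT_measurable => n.
  by rewrite -[X in measurable X]setTI; apply: measurable_tscaler.
have Nline w : N w -> forall z, F (z *: cembed w) = 0.
  move=> Nw z; have := @identity_theorem _ (fun t => F (0 + t *: cembed w)) 0.
  move=> /(_ (entire_line _ _ eF)) /(_ _ z); rewrite add0r; apply => e e0.
  pose n := Num.truncn e^-1.
  exists (n.+1%:R^-1)%:C; split.
  - by apply/eqP => /complexI/eqP; rewrite invr_eq0 pnatr_eq0.
  - rewrite subr0 nmR ger0_norm ?invr_ge0// -[e]invrK ltf_pV2 ?posrE ?invr_gt0//.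
    exact: truncnS_gt.
  - by rewrite add0r -cembed_tscale; exact: Nw.
exists N.
  split => //; apply: (surface_measure_cone0 mN mB) => // w r Nw r0.
  by rewrite /B/= cembed_tscale; exact: Nline.
move=> w Nw; apply: contrapT => Fw; apply: Nw => n _; rewrite /B/= cembed_tscale.
by apply/eqP; apply: contrapT => /negP h; apply: Fw; eexists; exact: h.
Qed.

(** Almost every [w] is a unit vector, has a nonzero slice and an integrable one by Fubini. If all
    of these had a positive line integral, the sphere would carry an almost everywhere positive
    function with nonpositive integral, although its measure is positive. *)
Lemma slice_exists : exists w, [/\ enorm w = 1,
  exists z, F (z *: cembed w) != 0,
  mu.-integrable setT (EFin \o (fun r : measurableTypeR R => f (tscale r w))) &
  (\int[mu]_r (f (tscale r w))%:E <= 0)%E].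
Proof.
have [_ _ intf If _] := aF.
have mEf : measurable_fun setT (EFin \o f) by exact/measurable_EFinP.
pose g (p : measurableTypeR R * d.+1.-tuple R) := (f (polar p))%:E.
have mg : measurable_fun setT g.
  exact: (measurableT_comp mEf (@measurable_polar R d.+1)).
have ig : (mu \x sigma)%E.-integrable setT g.
  apply/integrableP; split => //.
  have := ge0_integral_lift muN (measurableT_comp (@abse_measurable R setT) mEf)
    (fun=> abse_ge0 _).
  by move=> /= <-; have /integrableP[_ h] := intf; rewrite lte_add_pinfty.
have Ig : (\int[mu \x sigma]_p g p <= 0)%E.
  have pE := ge0_integral_lift muN (measurable_funepos mEf) (funepos_ge0 _).
  have nE := ge0_integral_lift muN (measurable_funeneg mEf) (funeneg_ge0 _).
  have fp := integrable_pos_fin_num measurableT intf.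
  have fn := integrable_neg_fin_num measurableT intf.
  move: If; rewrite integralE [in X in _ -> X]integralE.
  have gp : g^\+%E = (EFin \o f)^\+%E \o @polar R d.+1 by exact: funepos_comp.
  have gn : g^\-%E = (EFin \o f)^\-%E \o @polar R d.+1 by exact: funeneg_comp.
  rewrite gp gn -pE -nE !sube_le0 ?fin_numD ?fn ?fp//.
  by move=> h; exact: leeD.
have [N [mN N0] Nz] := null_set.
have aeint := ae_integrable2 ig.
have mG := measurable_fubini_G ig.
have IG : (\int[sigma]_w fubini_G mu g w <= 0)%E.
  by rewrite (integral21_prod_meas1 ig).
apply: contrapT => now.
suff G0 : {ae sigma, forall w, (0 < fubini_G mu g w)%E}.
  have := surface_measure_gt0 (R := R) d.
  by rewrite (ae_gt0_integral_le0 mG G0 IG) ltxx.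
have ae1 : {ae sigma, forall w, enorm w = 1}.
  exists [set w | enorm w != 1]; split => //.
  - rewrite (_ : mkset _ = enorm @^-1` (~` [set 1])).
      rewrite -[X in measurable X]setTI; apply: measurable_enorm => //.
      exact: measurableC.
    by apply/seteqP; split => x /eqP.
  - exact: surface_measure_off_sphere.
  - by move=> w /= /eqP.
have ae2 : {ae sigma, forall w, ~ N w}.
  by exists N; split => // w /= /contrapT.
near=> w.
rewrite ltNge; apply/negP => Gw; apply: now; exists w; split.
- by near: w.
- by apply: Nz; near: w.
- by near: w.
- exact: Gw.
Unshelve. all: by end_near. Qed.

Lemma slice_admissible : exists F1 : 'rV[R[i]]_1 -> R[i],
  [/\ admissible mu delta F1, exists z, F1 z != 0 &
      last_sign_change (restr_reals F1) <= last_sign_change (restr_reals F)].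
Proof.
have [[eF rF] tF intf If [r0 Fr0]] := aF.
have [w [w1 [c Fc] iw Iw]] := slice_exists.
pose F1 (z : 'rV[R[i]]_1) := F (z 0 0 *: cembed w).
have F1E (x : 1.-tuple R) : F1 (cembed x) = F (cembed (tscale (tnth x ord0) w)).
  by rewrite /F1 cembed_tscale mxE.
have f1E (x : 1.-tuple R) : restr_reals F1 x = f (tscale (tnth x ord0) w).
  by rewrite /restr_reals F1E.
have nE (x : 1.-tuple R) : enorm (tscale (tnth x ord0) w) = enorm x.
  by rewrite enorm_tscale w1 mulr1 enorm1_unit.
have mk : measurable_fun setT (fun r : measurableTypeR R => f (tscale r w)).
  by have /measurable_int /measurable_EFinP := iw.
have mf1 : measurable_fun setT (restr_reals F1).
  rewrite (_ : restr_reals F1 = f \o (fun x => tscale (tnth x ord0) w)).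
    apply: measurableT_comp => //; apply: measurable_tscale => //.
    exact: measurable_tnth.
  by apply/funext => x; rewrite f1E.
have fk (w' : 1.-tuple R) : enorm w' = 1 ->
    (forall r, restr_reals F1 (tscale r w') = f (tscale r w)) \/
    (forall r, restr_reals F1 (tscale r w') = f (tscale (- r) w)).
  rewrite enorm1_unit => h; have [p|p] := leP 0 (tnth w' ord0).
    left => r; rewrite f1E tnth_mktuple.
    by move: h; rewrite ger0_norm// => ->; rewrite mulr1.
  right => r; rewrite f1E tnth_mktuple.
  by move: h; rewrite ltr0_norm// => h; rewrite -[tnth w' ord0]opprK h mulrN1.
have s1 := surface_measure_gt0 (R := R) 0.
have [int1 Int1] := integrable_lift_radial muN s1 mf1 mk fk.
exists F1; split.
- split.
  + split; first exact: entire_slice.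
    by move=> x; rewrite F1E.
  + right; apply: le_trans (exp_type_slice F w1) _.
    by case: tF => // Fz; have [z] := F0; rewrite Fz eqxx.
  + exact/int1.
  + exact/Int1.
  + by exists r0 => x rx; rewrite f1E; apply: Fr0; rewrite nE.
- exists (c%:M); by rewrite /F1 mxE eqxx mulr1n.
- apply: last_sign_change_le; first by exists r0.
  by move=> r hr x rx; rewrite f1E; apply: hr; rewrite nE.
Qed.

End slice.
End restriction_to_lines.

(** * Radial extension *)

Section radial.
Context {R : realType}.

Lemma tnth_le_enorm d (t : d.-tuple R) i : `|tnth t i| <= enorm t.
Proof.
rewrite -sqrtr_sqr ler_wsqrtr// (bigD1 i)//= lerDl.
by rewrite sumr_ge0// => j _; exact: sqr_ge0.
Qed.

Lemma dual_norm_ge d (z : 'rV[R[i]]_d) (t : d.-tuple R) : enorm t <= 1 ->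
  nm (\sum_(i < d) z 0 i * (tnth t i)%:C) <= dual_norm z.
Proof.
move=> t1; apply: ub_le_sup; last by exists t.
exists (\sum_(i < d) nm (z 0 i)) => _ [u u1 <-].
apply: le_trans (nm_sum _ _ _) _; apply: ler_sum => i _.
rewrite nmM nmR ler_piMr ?nm_ge0//; exact: le_trans (tnth_le_enorm u i) u1.
Qed.

Lemma dual_norm_ge0 d (z : 'rV[R[i]]_d) : 0 <= dual_norm z.
Proof.
apply: le_trans (nm_ge0 _) (dual_norm_ge z (t := tzero) _).
rewrite (_ : tzero = tscale 0 tzero); last by rewrite tscale0.
by rewrite enorm_tscale normr0 mul0r.
Qed.

(* Dividing z by a square root of z.z, we may assume z.z = 1; then the real part
   a of z satisfies |a| >= 1, and z pairs with a / |a| to |a|. *)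
Lemma nm_sumsq_le d (z : 'rV[R[i]]_d) : nm (sumsq z) <= dual_norm z ^+ 2.
Proof.
pose q := sqrtc (sumsq z); have qE : q ^+ 2 = sumsq z by exact: sqr_sqrtc.
rewrite -qE nmX lerXn2r ?nnegrE ?nm_ge0 ?dual_norm_ge0//.
have [->|q0] := eqVneq q 0; first by rewrite Normc.normc0 dual_norm_ge0.
pose a := [tuple complex.Re (z 0 i / q) | i < d].
pose b := [tuple complex.Im (z 0 i / q) | i < d].
have zE i : z 0 i = q * (tnth a i +i* tnth b i).
  rewrite !tnth_mktuple [_ +i* _](_ : _ = z 0 i / q); last by case: (_ / _).
  by rewrite mulrC divfK.
have ab : \sum_(i < d) (tnth a i +i* tnth b i) ^+ 2 = 1.
  apply: (mulfI (_ : q ^+ 2 != 0)); first by rewrite expf_neq0.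
  rewrite mulr1 {2}qE mulr_sumr; apply: eq_bigr => i _.
  by rewrite zE exprMn.
have ReE : \sum_(i < d) (tnth a i ^+ 2 - tnth b i ^+ 2) = 1.
  move: ab => /(congr1 (@complex.Re R)); rewrite raddf_sum/= => <-.
  by apply: eq_bigr => i _; rewrite !expr2.
have ImE : \sum_(i < d) tnth b i * tnth a i = 0.
  move: ab => /(congr1 (@complex.Im R)); rewrite raddf_sum/= => E.
  apply: (mulfI (_ : 2 != 0 :> R)); first by rewrite pnatr_eq0.
  rewrite mulr0 -[RHS]E mulr_sumr; apply: eq_bigr => i _.
  by ring.
have a1 : 1 <= enorm a.
  rewrite -(@sqrtr1 R) ler_wsqrtr// -ReE; apply: ler_sum => i _.
  by rewrite lerBlDr lerDl sqr_ge0.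
have a0 : 0 < enorm a by exact: lt_le_trans a1.
have := dual_norm_ge z (t := tscale (enorm a)^-1 a).
rewrite enorm_normalize// => /(_ (lexx _)); apply: le_trans.
rewrite (_ : \sum_(i < d) _ = q * (enorm a)%:C).
  by rewrite nmM nmR (gtr0_norm a0) ler_peMr ?nm_ge0.
have -> : (enorm a)%:C = (enorm a)^-1%:C * ((\sum_(i < d) tnth a i ^+ 2) +i* (\sum_(i < d) tnth b i * tnth a i)).
  rewrite ImE -[\sum_(i < d) _](@sqr_sqrtr R); last first.
    by rewrite sumr_ge0// => i _; exact: sqr_ge0.
  rewrite -/(enorm a); apply/eqP; rewrite eq_complex/=; apply/andP; split; apply/eqP; field;
    by rewrite gt_eqF.
rewrite mulrA.
rewrite [_ +i* _](_ : _ = \sum_(i < d) (tnth a i +i* tnth b i) * (tnth a i)%:C); last first.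
  apply/eqP; rewrite eq_complex !raddf_sum/=; apply/andP; split; apply/eqP;
    by apply: eq_bigr => i _ /=; ring.
rewrite mulr_sumr; apply: eq_bigr => i _.
by rewrite {1}zE [tnth (tscale _ _) i]tnth_mktuple rmorphM; ring.
Qed.

Lemma exp_type_growth d (F : 'rV[R[i]]_d -> R[i]) (delta e : R) :
  (exp_type F <= delta%:E)%E -> 0 < e -> exists M : R,
    forall z, M < dual_norm z -> nm (F z) <= expR ((delta + e) * dual_norm z).
Proof.
move=> tF e0; have : (exp_type F < (delta + e)%:E)%E.
  by apply: le_lt_trans tF _; rewrite lte_fin ltrDl.
move=> /ereal_inf_lt [_ [V [M _ MV] <-] h].
exists (Num.max M 0) => z; rewrite gt_max => /andP[/MV Vz z0].
have := le_lt_trans (ereal_sup_ubound _) h =>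
  /(_ (((dual_norm z)^-1)%:E * lne (nm (F z))%:E)%E).
move=> /(_ ltac:(by exists z)) /ltW.
have [->|Fz] := eqVneq (nm (F z)) 0; first by rewrite expR_ge0.
have Fz0 : 0 < nm (F z) by rewrite lt_def Fz nm_ge0.
rewrite lne_EFin// -EFinM lee_fin mulrC ler_pdivrMr// => hl.
by rewrite -[leLHS]lnK ?posrE// ler_expR.
Qed.

Lemma growth_exp_type d (F : 'rV[R[i]]_d -> R[i]) (delta : R) :
  (forall e, 0 < e -> exists C : R,
    forall z, nm (F z) <= C * expR ((delta + e) * dual_norm z)) ->
  (exp_type F <= delta%:E)%E.
Proof.
move=> H; apply/lee_addgt0Pr => e e0.
have e2 : 0 < e / 2 by rewrite divr_gt0.
have [C0 HC0] := H _ e2; pose C := Num.max C0 1.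
have C1 : 1 <= C by rewrite le_max lexx orbT.
have C0' : 0 < C by exact: lt_le_trans C1.
have HC z : nm (F z) <= C * expR ((delta + e / 2) * dual_norm z).
  apply: le_trans (HC0 z) _; rewrite ler_wpM2r ?expR_ge0//.
  by rewrite le_max lexx.
(* Beyond this radius ln C <= (e / 2) ||z||, so the constant is absorbed by half of the slack; C >=
   1 makes M >= 0 and hence ||z|| > 0 there. *)
pose M := ln C / (e / 2).
have M0 : 0 <= M by rewrite divr_ge0 ?(ltW e2)// ln_ge0.
apply: ereal_inf_le; exists (ereal_sup [set (((dual_norm z)^-1)%:E *
    lne (nm (F z))%:E)%E | z in [set z : 'rV[R[i]]_d | M < dual_norm z]]).
  by exists [set z : 'rV[R[i]]_d | M < dual_norm z] => //; exists M.
apply: ge_ereal_sup => _ [z Mz <-]; rewrite /mkset in Mz.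
have z0 : 0 < dual_norm z by exact: le_lt_trans Mz.
have [->|Fz] := eqVneq (nm (F z)) 0.
  by rewrite le0_lneNy// gt0_muleNy ?lte_fin ?invr_gt0// leNye.
have Fz0 : 0 < nm (F z) by rewrite lt_def Fz nm_ge0.
rewrite lne_EFin// -EFinM -EFinD lee_fin mulrC ler_pdivrMr//.
have : ln (nm (F z)) <= ln (C * expR ((delta + e / 2) * dual_norm z)).
  by rewrite ler_ln ?posrE// mulr_gt0// expR_gt0.
rewrite lnM ?posrE ?expR_gt0// expRK => /le_trans; apply.
move: Mz; rewrite /M ltr_pdivrMr// => /ltW Mz.
rewrite [leRHS](_ : _ = dual_norm z * (e / 2) + (delta + e / 2) * dual_norm z); last by field.
by rewrite lerD2r.
Qed.

Section extension.
Variables (mu : {sigma_finite_measure set (measurableTypeR R) -> \bar R}).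
Hypothesis muN : even_measure mu.
Variables (delta : R) (d : nat) (F : 'rV[R[i]]_1 -> R[i]).
Hypotheses (delta0 : 0 <= delta) (aF : admissible mu delta F).
Hypothesis F0 : exists z, F z != 0.

Let Fl (t : R[i]) := F (t *: cembed [tuple 1]).
Let phi (r : measurableTypeR R) : R := restr_reals F (tscale r [tuple 1]).

Let FlE z : F z = Fl (z 0 0).
Proof.
congr F; apply/rowP => i; rewrite !mxE ord1 (tnth_nth 0)/=.
by rewrite mulr1.
Qed.

Let hFl : holo Fl.
Proof.
have [[eF _] _ _ _ _] := aF; move=> z.
have [l Hl] := entire_line 0 (cembed [tuple 1]) eF z; exists l.
by apply: der_ext Hl => t; rewrite add0r.
Qed.

Let Fl_real (r : R) : Fl r%:C = (phi r)%:C.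
Proof.
have [[_ rF] _ _ _ _] := aF.
rewrite /Fl -cembed_tscale [LHS]complexE rF mulr0 addr0.
by [].
Qed.

Let restrE (x : 1.-tuple R) : restr_reals F x = phi (tnth x ord0).
Proof.
congr restr_reals; apply: eq_from_tnth => i; rewrite tnth_mktuple ord1.
by rewrite [tnth [tuple 1] _](tnth_nth 0)/= mulr1.
Qed.

Let mphi : measurable_fun setT phi.
Proof.
have [_ _ /measurable_int /measurable_EFinP mf _ _] := aF.
apply: (measurableT_comp mf); apply: measurable_tscale; last exact: measurable_cst.
by move=> _ A mA; rewrite setTI.
Qed.

(** The transfer from the lift allows either orientation of the line, so it applies to the reflected
    function with its two alternatives exchanged. *)
Let phiN_integrable :
  mu.-integrable setT (EFin \o (phi \o -%R)) /\
  (\int[mu]_r ((phi \o -%R) r)%:E <= 0)%E.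
Proof.
have [_ _ intf If _] := aF.
have mf : measurable_fun setT (restr_reals F).
  by have /measurable_int /measurable_EFinP := intf.
have mphiN : measurable_fun setT (phi \o -%R : measurableTypeR R -> R).
  exact: (measurableT_comp mphi (@oppr_measurable R setT)).
have fk (w : 1.-tuple R) : enorm w = 1 ->
    (forall r, restr_reals F (tscale r w) = (phi \o -%R) r) \/
    (forall r, restr_reals F (tscale r w) = (phi \o -%R) (- r)).
  rewrite enorm1_unit => h; have [p|p] := leP 0 (tnth w ord0).
    right => r; rewrite restrE tnth_mktuple /= opprK.
    by move: h; rewrite ger0_norm// => ->; rewrite mulr1.
  left => r; rewrite restrE tnth_mktuple /=.
  by move: h; rewrite ltr0_norm// => h; rewrite -[tnth w ord0]opprK h mulrN1.
have [[h1 _] h2] := integrable_lift_radial muN (surface_measure_gt0 (R := R) 0) mf mphiN fk.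
by split; [exact: h1|exact/h2/If/h1].
Qed.

Let phi_integrable :
  mu.-integrable setT (EFin \o phi) /\ (\int[mu]_r (phi r)%:E <= 0)%E.
Proof.
have [_ _ intf If _] := aF.
have mf : measurable_fun setT (restr_reals F).
  by have /measurable_int /measurable_EFinP := intf.
have fk (w : 1.-tuple R) : enorm w = 1 ->
    (forall r, restr_reals F (tscale r w) = phi r) \/
    (forall r, restr_reals F (tscale r w) = phi (- r)).
  rewrite enorm1_unit => h; have [p|p] := leP 0 (tnth w ord0).
    left => r; rewrite restrE tnth_mktuple.
    by move: h; rewrite ger0_norm// => ->; rewrite mulr1.
  right => r; rewrite restrE tnth_mktuple.
  by move: h; rewrite ltr0_norm// => h; rewrite -[tnth w ord0]opprK h mulrN1.
have [[h1 _] h2] := integrable_lift_radial muN (surface_measure_gt0 (R := R) 0) mf mphi fk.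
by split; [exact: h1|exact/h2/If/h1].
Qed.

Let k (r : measurableTypeR R) : R := phi r + phi (- r).

Let k_integrable :
  mu.-integrable setT (EFin \o k) /\ (\int[mu]_r (k r)%:E <= 0)%E.
Proof.
have [i1 I1] := phi_integrable; have [i2 I2] := phiN_integrable.
have E : EFin \o k = ((EFin \o phi) \+ (EFin \o (phi \o -%R)))%E.
  by apply/funext => r.
split; first by rewrite E; exact: integrableD.
have -> : (\int[mu]_r (k r)%:E = \int[mu]_r (phi r)%:E + \int[mu]_r ((phi \o -%R) r)%:E)%E.
  by rewrite -integralD.
exact: adde_le0.
Qed.

Let phi_ge0 r0 : (forall x, r0 <= enorm x -> 0 <= restr_reals F x) ->
  forall r, r0 <= `|r| -> 0 <= phi r.
Proof. by move=> h r hr; apply: h; rewrite enorm1_unit tnth_mktuple (tnth_nth 0)/= mulr1. Qed.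

Let e (t : R[i]) := Fl t + Fl (- t).

Let he : holo e.
Proof.
move=> z; have [l Hl] := hFl z; have [m Hm] := hFl (- z).
exists (l + m * - 1); apply: derD => //.
exact: (der_comp (g := fun t => - t) Hm (derN (cder_id z))).
Qed.

(** If the symmetrization were zero, phi(r) and phi(-r) would be opposite and both non-negative for
    large r. Then phi vanishes on a half-line, and zeros accumulating at r1 + 1 make F identically
    zero. *)
Let e_neq0 : exists t, e t != 0.
Proof.
have [_ _ _ _ [r0 Fr0]] := aF; have phi0 := phi_ge0 Fr0.
apply: contrapT => ne.
have e0 t : e t = 0 by apply/eqP; apply: contrapT => /negP h; apply: ne; exists t.
have [z] := F0; rewrite FlE => /eqP; apply.
pose r1 : R := Num.max r0 1.
apply: (identity_theorem (w := (r1 + 1)%:C) hFl) => s s0.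
exists (r1 + 1 + s / 2)%:C; split.
- by apply/eqP => /complexI/eqP; rewrite eq_sym -subr_eq0 opprD addNKr oppr_eq0 gt_eqF ?divr_gt0.
- by rewrite -rmorphB nmR addrAC subrr add0r ger0_norm ?divr_ge0 ?ltW// ltr_pdivrMr//; lra.
- rewrite Fl_real; set r := r1 + 1 + s / 2.
  have rr : r0 <= r.
    have : r0 <= r1 by rewrite le_max lexx.
    by rewrite /r; lra.
  have r00 : 0 <= r.
    have : 1 <= r1 by rewrite le_max lexx orbT.
    by rewrite /r; lra.
  have p1 : 0 <= phi r by apply: phi0; rewrite ger0_norm.
  have p2 : 0 <= phi (- r) by apply: phi0; rewrite normrN ger0_norm.
  have := e0 r%:C; rewrite /e -rmorphN !Fl_real -rmorphD => /complexI /eqP.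
  by rewrite paddr_eq0// => /andP[/eqP -> _].
Qed.

Let e_growth eps : 0 < eps ->
  exists C : R, forall t, nm (e t) <= C * expR ((delta + eps) * nm t).
Proof.
move=> eps0; have [_ tF _ _ _] := aF.
have {}tF : (exp_type F <= delta%:E)%E.
  by case: tF => // Fz; have [z] := F0; rewrite Fz eqxx.
have [M HM] := exp_type_growth tF eps0.
have [K K0 HK] := holo_bounded M he.
(* [K] covers the disc where the type gives no bound, and 2 counts the terms Fl(t) and Fl(-t)
   outside it. *)
exists (K + 2) => t; have [tM|Mt] := leP (nm t) M.
  apply: le_trans (HK _ tM) _; apply: le_trans (_ : K + 2 <= _); first by rewrite lerDl.
  rewrite ler_peMr ?addr_ge0//.
  by rewrite -expR0 ler_expR mulr_ge0 ?nm_ge0// addr_ge0// ltW.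
have b u : nm u = nm t -> nm (Fl u) <= expR ((delta + eps) * nm t).
  move=> ut; have := HM (u *: cembed [tuple 1]).
  by rewrite dual_norm_line ?ut//; [apply|rewrite enorm1_unit normr1].
apply: le_trans (nmD _ _) _.
have b1 := b t erefl; have b2 := b (- t) (nmN t).
have E0 := expR_ge0 ((delta + eps) * nm t).
have KE : 0 <= K * expR ((delta + eps) * nm t) by rewrite mulr_ge0.
rewrite mulrDl; lra.
Qed.

Lemma radial_admissible : exists G : 'rV[R[i]]_d.+1 -> R[i],
  [/\ admissible mu delta G, exists z, G z != 0 &
      last_sign_change (restr_reals G) <= last_sign_change (restr_reals F)].
Proof.
have [_ _ _ _ [r0 Fr0]] := aF.
have [h hh hE] : exists2 h, holo h & forall z, h (z ^+ 2) = e z.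
  by apply: even_factor he _ => z; rewrite /e opprK addrC.
pose G (z : 'rV[R[i]]_d.+1) := h (sumsq z).
have GE x : G (cembed x) = (k (enorm x))%:C.
  rewrite /G (_ : sumsq _ = (enorm x)%:C ^+ 2).
    by rewrite hE /e -rmorphN !Fl_real -rmorphD.
  rewrite -rmorphXn sqr_sqrtr; last by rewrite sumr_ge0// => i _; exact: sqr_ge0.
  by rewrite rmorph_sum; apply: eq_bigr => i _; rewrite mxE rmorphXn.
have gE x : restr_reals G x = k (enorm x) by rewrite /restr_reals GE.
have kN r : k (- r) = k r by rewrite /k opprK addrC.
have mk : measurable_fun setT k.
  by have [/measurable_int /measurable_EFinP] := k_integrable.
have mg : measurable_fun setT (restr_reals G).
  rewrite (_ : restr_reals G = k \o enorm); last by apply/funext => x; rewrite gE.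
  by apply: measurableT_comp => //; exact: measurable_enorm.
have fk (w : d.+1.-tuple R) : enorm w = 1 ->
    (forall r, restr_reals G (tscale r w) = k r) \/
    (forall r, restr_reals G (tscale r w) = k (- r)).
  move=> w1; left => r; rewrite gE enorm_tscale w1 mulr1.
  by have [p|p] := leP 0 r; [rewrite ger0_norm|rewrite ltr0_norm// kN].
have [intG IntG] := integrable_lift_radial muN (surface_measure_gt0 (R := R) d) mg mk fk.
have [ik Ik] := k_integrable.
have g_ge0 r : (forall x, r <= enorm x -> 0 <= restr_reals F x) ->
    forall x, r <= enorm x -> 0 <= restr_reals G x.
  move=> /phi_ge0 p x rx; rewrite gE addr_ge0// p ?normrN//.
    by rewrite ger0_norm// enorm_ge0.
  by rewrite ger0_norm// enorm_ge0.
exists G; split.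
- split.
  + split; first exact: entire_sumsq.
    by move=> x; rewrite GE.
  + right; apply: growth_exp_type => eps eps0; have [C HC] := e_growth eps0.
    have C0 : 0 <= C.
      have := HC 0; rewrite Normc.normc0 mulr0 expR0 mulr1.
      exact: le_trans (nm_ge0 _).
    exists C => z; pose q := sqrtc (sumsq z).
    have qE : q ^+ 2 = sumsq z by exact: sqr_sqrtc.
    rewrite /G -qE hE; apply: le_trans (HC q) _; rewrite ler_wpM2l// ler_expR.
    (* The assumption delta >= 0 enters here: |q| <= ||z|| compares the exponents only with a
       non-negative factor. *)
    rewrite ler_wpM2l ?addr_ge0 ?(ltW eps0)//.
    rewrite -(ler_pXn2r (n := 2)) ?nnegrE ?nm_ge0 ?dual_norm_ge0//.
    by rewrite -nmX qE; exact: nm_sumsq_le.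
  + exact/intG.
  + exact/IntG.
  + by exists r0; exact: g_ge0.
- have [t et] := e_neq0; exists (\row_i (if i == 0 then t else 0)).
  rewrite /G (_ : sumsq _ = t ^+ 2) ?hE//.
  rewrite /sumsq big_ord_recl mxE eqxx big1 ?addr0// => i _.
  by rewrite mxE expr0n.
- by apply: last_sign_change_le; [exists r0|exact: g_ge0].
Qed.

End extension.
End radial.

Theorem theorem1 (R : realType) (mu : {measure set (measurableTypeR R) -> \bar R})
  (delta : R) (d : nat) :
  locally_finite mu -> even_measure mu -> 0 <= delta -> (1 <= d)%N ->
  extremal_radius mu delta d = extremal_radius mu delta 1.
Proof.
move=> lf muN delta0; case: d => // d _.
have [nu nuE] := sigma_finiteP (locally_finite_sigma_finite lf).
rewrite nuE in muN *.
apply/eqP; rewrite eq_le; apply/andP; split; apply: le_ereal_inf_tmp => _ [F [aF F0] <-].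
  have [G [aG G0 le]] := radial_admissible muN d delta0 aF F0.
  apply: ereal_inf_le; exists (last_sign_change (restr_reals G))%:E => //.
  by exists G.
have [G [aG G0 le]] := slice_admissible muN aF F0.
apply: ereal_inf_le; exists (last_sign_change (restr_reals G))%:E => //.
by exists G.
Qed.
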